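(* Let $M\in\mathcal{F}(\nabla)$ and $N\in\mathcal{F}(\Delta)$ be indecomposable $\Lambda_n$-modules such that $M$ and $N$ are self-orthogonal and $M,N\notin\mathcal{F}(\Delta)\cap\mathcal{F}(\nabla)$. Then $\operatorname{Ext}^m_{\Lambda_n}(M,N)\neq0$ for some $m\geq1$.
   Context: Let $\Bbbk$ be an algebraically closed field and $n\geq 2$. $\Lambda_n$ is the path algebra over $\Bbbk$ of the quiver with vertices $1,\dots,n$ and arrows $\alpha_i:i\to i+1$, $\alpha_i':i+1\to i$ ($1\leq i\leq n-1$), modulo the relations $\alpha_{i+1}\alpha_i=0$, $\alpha_i'\alpha_{i+1}'=0$ ($1\leq i\leq n-2$) and $\alpha_i\alpha_i'=0$ ($1\leq i\leq n-1$); products are composed right to left ($\beta\alpha$ means first $\alpha$, then $\beta$). Modules are finite-dimensional left modules. $L(i)$ is the simple module at vertex $i$. $\Lambda_n$ is quasi-hereditary for the natural order on $\{1,\dots,n\}$, with standard modules $\Delta(1)=L(1)$ and, for $i\geq 2$, $\Delta(i)$ uniserial of length two with top $L(i)$ and socle $L(i-1)$, and costandard modules $\nabla(1)=L(1)$ and, for $i\geq2$, $\nabla(i)$ uniserial of length two with top $L(i-1)$ and socle $L(i)$. $\mathcal{F}(\Delta)$ (resp. $\mathcal{F}(\nabla)$) is the full subcategory of modules having a finite filtration with standard (resp. costandard) subquotients. A module $M$ is self-orthogonal if $\operatorname{Ext}^m_{\Lambda_n}(M,M)=0$ for all $m\geq1$. *)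

(* Defs.v *)
From HB Require Import structures.
From mathcomp Require Import all_boot all_order all_algebra.
From mathcomp Require Import finmap generic_quotient ring_quotient.
From mathcomp Require Import monalg.
From mathcomp Require Import boolp.

Set Implicit Arguments.
Unset Strict Implicit.
Unset Printing Implicit Defensive.

Import GRing.Theory.
Local Open Scope ring_scope.
Local Open Scope quotient_scope.

Section LinearExtension.
Variables (K : fieldType) (T : choiceType) (V : lmodType K).
Implicit Types (h : T -> V) (g : {malg K[T]}).

Definition lext h g : V := \sum_(t <- msupp g) g@_t *: h t.

Lemma lextEw h g (d : {fset T}) : (msupp g `<=` d)%fset ->
  lext h g = \sum_(t <- d) g@_t *: h t.
Proof.
move=> le; apply: big_fset_incl => // t _ /mcoeff_outdom ->.
by rewrite scale0r.
Qed.

Lemma lext_linear h : linear (lext h).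
Proof.
move=> a g1 g2; pose d := (msupp g1 `|` msupp g2 `|` msupp (a *: g1 + g2))%fset.
rewrite !(@lextEw h _ d) ?fsubsetUr //; last first.
- by rewrite /d -fsetUA fsubsetUl.
- by rewrite /d (fsetUC (msupp g1)) -fsetUA fsubsetUl.
rewrite scaler_sumr -big_split; apply: eq_bigr => t _ /=.
by rewrite mcoeffD mcoeffZ scalerDl scalerA.
Qed.

HB.instance Definition _ h :=
  GRing.isLinear.Build K {malg K[T]} V *:%R (lext h) (lext_linear h).

Lemma lextU h t : lext h << t >> = h t.
Proof. by rewrite (lextEw _ (@msuppU_le _ _ _ _)) big_seq_fset1 mcoeffUU scale1r. Qed.

Lemma lext_funD h1 h2 g : lext (fun t => h1 t + h2 t) g = lext h1 g + lext h2 g.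
Proof. by rewrite /lext -big_split; apply: eq_bigr => t _; rewrite scalerDr. Qed.

Lemma lext_funZ (a : K) h g : lext (fun t => a *: h t) g = a *: lext h g.
Proof.
rewrite /lext scaler_sumr; apply: eq_bigr => t _.
by rewrite !scalerA mulrC.
Qed.

Lemma linear_malg_eq (f1 f2 : {malg K[T]} -> V) : linear f1 -> linear f2 ->
  (forall t, f1 << t >> = f2 << t >>) -> f1 =1 f2.
Proof.
move=> l1 l2 e g.
pose h1 := GRing.isLinear.Build _ _ _ _ f1 l1.
pose F1 : {linear _ -> _} := HB.pack f1 h1.
pose h2 := GRing.isLinear.Build _ _ _ _ f2 l2.
pose F2 : {linear _ -> _} := HB.pack f2 h2.
rewrite -[f1]/(F1 : _ -> _) -[f2]/(F2 : _ -> _) [g]monalgE !linear_sum.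
apply: eq_bigr => t _.
have -> : << g@_t *g t >> = g@_t *: << t >> :> {malg K[T]}.
  by apply/malgP => u; rewrite mcoeffZ !mcoeffU mulrnAr mulr1.
by rewrite !linearZ /= e.
Qed.

End LinearExtension.

(* The base vertex only records that there is at least one vertex, so that the
   path algebra is a nonzero ring. *)
Record quiver := Quiver {
  vertex : finType;
  arrow : finType;
  source : arrow -> vertex;
  target : arrow -> vertex;
  base_vertex : vertex
}.

Section PathAlgebra.
Variable Q : quiver.

(* A path is a starting vertex with the arrows it runs through, in the order
   in which they are traversed; the empty sequence gives the trivial path. *)
Fixpoint is_qpath (x : vertex Q) (s : seq (arrow Q)) : bool :=
  if s is a :: s' then (source a == x) && is_qpath (target a) s' else true.

Definition qend (x : vertex Q) (s : seq (arrow Q)) : vertex Q :=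
  last x [seq target a | a <- s].

Record qpath := QPath {
  qpath_val :> vertex Q * seq (arrow Q);
  _ : is_qpath qpath_val.1 qpath_val.2
}.
HB.instance Definition _ := [isSub for qpath_val].
HB.instance Definition _ := [Choice of qpath by <:].

Definition pstart (p : qpath) : vertex Q := (val p).1.
Definition parrows (p : qpath) : seq (arrow Q) := (val p).2.
Definition pend (p : qpath) : vertex Q := qend (pstart p) (parrows p).

Definition trivial_path (x : vertex Q) : qpath := @QPath (x, [::]) isT.

Lemma arrow_path_subproof a : is_qpath (source a) [:: a].
Proof. by rewrite /= eqxx. Qed.
Definition arrow_path (a : arrow Q) : qpath :=
  @QPath (source a, [:: a]) (arrow_path_subproof a).

(* [pcomp q p] is the composite "first p, then q". *)
Definition pcomp (q p : qpath) : option qpath :=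
  if pend p == pstart q then insub (pstart p, parrows p ++ parrows q) else None.

Lemma is_qpath_cat x s t :
  is_qpath x (s ++ t) = is_qpath x s && is_qpath (qend x s) t.
Proof. by elim: s x => //= a s IH x; rewrite IH andbA. Qed.

Lemma qend_cat x s t : qend x (s ++ t) = qend (qend x s) t.
Proof. by rewrite /qend map_cat last_cat. Qed.

Lemma pcompP q p : pend p = pstart q ->
  exists2 r, pcomp q p = Some r &
    [/\ pstart r = pstart p, pend r = pend q
      & parrows r = parrows p ++ parrows q].
Proof.
move=> e; rewrite /pcomp e eqxx; case: insubP => [r _ er|].
  exists r => //; rewrite /pend /pstart /parrows er; split=> //=.
  by rewrite qend_cat -/(pstart p) -/(parrows p) -/(pend p) e.
by rewrite /= is_qpath_cat -/(pend p) e (valP p) (valP q).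
Qed.

Lemma pcompN q p : pend p <> pstart q -> pcomp q p = None.
Proof. by move=> /eqP/negPf; rewrite /pcomp => ->. Qed.

Lemma pcompA p q r :
  obind (fun s => pcomp s r) (pcomp p q) = obind (pcomp p) (pcomp q r).
Proof.
have [e1|n1] := eqVneq (pend q) (pstart p); last first.
  rewrite (pcompN (elimN eqP n1)) /=.
  have [e2|n2] := eqVneq (pend r) (pstart q).
    have [s -> [_ es _]] := pcompP e2; rewrite /= pcompN // es.
    exact/eqP.
  by rewrite (pcompN (elimN eqP n2)).
have [s -> [s1 s2 s3]] := pcompP e1.
have [e2|n2] := eqVneq (pend r) (pstart q); last first.
  by rewrite (pcompN (elimN eqP n2)) /= pcompN // s1; apply/eqP.
have [t -> [t1 t2 t3]] := pcompP e2 => /=.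
have [|u -> [u1 u2 u3]] := @pcompP s r; first by rewrite e2 s1.
have [|v -> [v1 v2 v3]] := @pcompP p t; first by rewrite t2 e1.
congr Some; apply/val_inj/eqP; rewrite -pair_eqE /=.
rewrite -/(pstart u) -/(pstart v) -/(parrows u) -/(parrows v).
by rewrite u1 v1 t1 u3 v3 s3 t3 catA !eqxx.
Qed.

Lemma pcomp_triv p x :
  pcomp p (trivial_path x) = if x == pstart p then Some p else None.
Proof.
rewrite /pcomp -[pend (trivial_path x)]/x; case: eqP => // ->.
case: insubP => [r _ er|]; last by rewrite /= (valP p).
by congr Some; apply/val_inj; rewrite er /pstart /parrows; case: (val p).
Qed.

Lemma triv_pcomp p x :
  pcomp (trivial_path x) p = if x == pend p then Some p else None.
Proof.
rewrite /pcomp eq_sym -[pstart (trivial_path x)]/x; case: eqP => // _.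
case: insubP => [r _ er|].
  by congr Some; apply/val_inj; rewrite er cats0 /pstart /parrows; case: (val p).
by rewrite /= cats0 (valP p).
Qed.

Variable K : fieldType.

Definition path_algebra : Type := {malg K[qpath]}.
HB.instance Definition _ := GRing.Lmodule.on path_algebra.

Definition pbasis (p : qpath) : path_algebra := << p >>.
Definition obasis (o : option qpath) : path_algebra := oapp pbasis 0 o.

Lemma obasisS p : obasis (Some p) = pbasis p. Proof. by []. Qed.
Lemma obasisN : obasis None = 0. Proof. by []. Qed.

Definition pamul (g1 g2 : path_algebra) : path_algebra :=
  lext (fun p => lext (fun q => obasis (pcomp p q)) g2) g1.
Definition paone : path_algebra := \sum_(x : vertex Q) pbasis (trivial_path x).

Lemma pamulDl g : linear (pamul^~ g).
Proof. by move=> a x y; rewrite /pamul linearP. Qed.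

Lemma pamulDr g : linear (pamul g).
Proof.
move=> a x y; rewrite /pamul -lext_funZ -lext_funD; congr (lext _ g).
by apply/funext => p; rewrite linearP.
Qed.

Lemma pamulbb p q : pamul (pbasis p) (pbasis q) = obasis (pcomp p q).
Proof. by rewrite /pamul !lextU. Qed.

Lemma pamul0 g : pamul g 0 = 0.
Proof. by have := pamulDr g (-1) 0 0; rewrite !scaleN1r !addNr. Qed.

Lemma pa0mul g : pamul 0 g = 0.
Proof. by have := pamulDl g (-1) 0 0; rewrite !scaleN1r !addNr. Qed.

Lemma pamulA : associative pamul.
Proof.
move=> x y z; move: x; apply: (linear_malg_eq (V := path_algebra)).
- by move=> a u v; rewrite pamulDl.
- by move=> a u v; rewrite !pamulDl.
move=> p; move: y; apply: (linear_malg_eq (V := path_algebra)).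
- by move=> a u v; rewrite pamulDl pamulDr.
- by move=> a u v; rewrite pamulDr pamulDl.
move=> q; move: z; apply: (linear_malg_eq (V := path_algebra)).
- by move=> a u v; rewrite !pamulDr.
- by move=> a u v; rewrite pamulDr.
move=> r; rewrite -/(pbasis p) -/(pbasis q) -/(pbasis r) !pamulbb.
have := pcompA p q r.
case: (pcomp p q) (pcomp q r) => [s|] [t|]; rewrite ?obasisS ?obasisN /obind /oapp.
- by rewrite !pamulbb => ->.
- by rewrite pamul0 pamulbb => ->.
- by rewrite pa0mul pamulbb => <-.
- by rewrite pamul0 pa0mul.
Qed.

Lemma pa1mul : left_id paone pamul.
Proof.
apply: (linear_malg_eq (V := path_algebra)).
- exact: pamulDr.
- by [].
move=> p; rewrite /paone.
have lin := @pamulDl (pbasis p).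
pose h := GRing.isLinear.Build _ _ _ _ _ lin.
pose F : {linear _ -> _} := HB.pack (pamul^~ (pbasis p)) h.
rewrite -/(pbasis p) -[LHS]/(F _) linear_sum (bigD1 (pend p)) //= big1 => [|x nx].
  by rewrite /F /= pamulbb triv_pcomp eqxx addr0.
by rewrite /F /= pamulbb triv_pcomp (negPf nx).
Qed.

Lemma pamul1 : right_id paone pamul.
Proof.
apply: (linear_malg_eq (V := path_algebra)).
- exact: pamulDl.
- by [].
move=> p; rewrite /paone.
have lin := @pamulDr (pbasis p).
pose h := GRing.isLinear.Build _ _ _ _ _ lin.
pose F : {linear _ -> _} := HB.pack (pamul (pbasis p)) h.
rewrite -/(pbasis p) -[LHS]/(F _) linear_sum (bigD1 (pstart p)) //= big1 => [|x nx].
  by rewrite /F /= pamulbb pcomp_triv eqxx addr0.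
by rewrite /F /= pamulbb pcomp_triv (negPf nx).
Qed.

Lemma pamul_addl : left_distributive pamul +%R.
Proof. by move=> x y z; have := pamulDl z 1 x y; rewrite !scale1r. Qed.
Lemma pamul_addr : right_distributive pamul +%R.
Proof. by move=> x y z; have := pamulDr x 1 y z; rewrite !scale1r. Qed.

Lemma paoneE x : paone@_(trivial_path x) = 1.
Proof.
rewrite /paone raddf_sum (bigD1 x) //= big1 => [|y nyx].
  by rewrite mcoeffUU addr0.
rewrite mcoeffU; case: eqP => // /(congr1 pstart) eyx.
by rewrite -[y]/(pstart (trivial_path y)) eyx eqxx in nyx.
Qed.

Lemma paone_neq0 : paone != 0.
Proof.
apply/eqP => /(congr1 (mcoeff (trivial_path (base_vertex Q)))) /eqP.
by rewrite paoneE mcoeff0 oner_eq0.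
Qed.

HB.instance Definition _ := GRing.Zmodule_isNzRing.Build path_algebra
  pamulA pa1mul pamul1 pamul_addl pamul_addr paone_neq0.

Lemma pa_scaleAl (k : K) (x y : path_algebra) : k *: (x * y) = (k *: x) * y.
Proof. by have := pamulDl y k x 0; rewrite pa0mul !addr0. Qed.
Lemma pa_scaleAr (k : K) (x y : path_algebra) : k *: (x * y) = x * (k *: y).
Proof. by have := pamulDr x k y 0; rewrite pamul0 !addr0. Qed.

HB.instance Definition _ := GRing.Lmodule_isLalgebra.Build K path_algebra pa_scaleAl.
HB.instance Definition _ := GRing.Lalgebra_isAlgebra.Build K path_algebra pa_scaleAr.

Definition vtx (x : vertex Q) : path_algebra := pbasis (trivial_path x).
Definition arr (a : arrow Q) : path_algebra := pbasis (arrow_path a).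

Lemma mcoeff_arr a x : (arr a)@_(trivial_path x) = 0.
Proof.
rewrite /arr /pbasis mcoeffU; case: eqP => [e|]; last by rewrite mulr0n.
by have := congr1 parrows e.
Qed.

Lemma pcomp_eq_triv p q x : pcomp p q = Some (trivial_path x) ->
  p = trivial_path x /\ q = trivial_path x.
Proof.
move=> e; have [epq|/eqP npq] := eqVneq (pend q) (pstart p); last first.
  by rewrite pcompN in e.
have [r er [r1 r2 r3]] := pcompP epq; move: er; rewrite e => -[er]; subst r.
have /esym/eqP := r3.
rewrite [parrows (trivial_path x)]/= -size_eq0 size_cat addn_eq0 !size_eq0.
case/andP=> /eqP q0 /eqP p0.
have qx : pstart q = x by rewrite -r1.
have px : pstart p = x by rewrite -epq /pend q0 qx.
split; apply/val_inj/eqP; rewrite -pair_eqE /=.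
  by rewrite -/(pstart p) -/(parrows p) px p0 !eqxx.
by rewrite -/(pstart q) -/(parrows q) qx q0 !eqxx.
Qed.

Lemma mcoeff_trivM x (g h : path_algebra) :
  (g * h)@_(trivial_path x) = g@_(trivial_path x) * h@_(trivial_path x).
Proof.
move: g; apply: (linear_malg_eq (V := K^o)).
- by move=> a u v; rewrite -[_ * h]/(pamul _ h) pamulDl mcoeffD mcoeffZ.
- by move=> a u v; rewrite mcoeffD mcoeffZ mulrDl -mulrA.
move=> p; move: h; apply: (linear_malg_eq (V := K^o)).
- by move=> a u v; rewrite -[_ * _]/(pamul _ _) pamulDr mcoeffD mcoeffZ.
- by move=> a u v; rewrite mcoeffD mcoeffZ mulrDr mulrCA.
move=> q; rewrite -[_ * _ in LHS]/(pamul (pbasis p) (pbasis q)) pamulbb.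
rewrite !mcoeffU.
case E : (pcomp p q) => [r|] /=; last first.
  rewrite mcoeff0; case: eqP => [ep|_]; last by rewrite mul0r.
  case: eqP => [eq|_]; last by rewrite mulr0.
  by move: E; rewrite ep eq pcomp_triv eqxx.
rewrite mcoeffU; case: eqP => [er|nr]; last first.
  case: eqP => [ep|_]; last by rewrite mul0r.
  case: eqP => [eq|_]; last by rewrite mulr0.
  by case: nr; move: E; rewrite ep eq pcomp_triv eqxx => -[].
by move: E; rewrite er => /pcomp_eq_triv[-> ->]; rewrite !eqxx mulr1.
Qed.

Lemma mcoeff_arrM a (g : path_algebra) x : (arr a * g)@_(trivial_path x) = 0.
Proof. by rewrite mcoeff_trivM mcoeff_arr mul0r. Qed.

End PathAlgebra.

Section IdealQuotient.
Variables (K : fieldType) (A : algType K) (rel : A -> Prop).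

Definition two_sided_ideal (J : A -> Prop) : Prop :=
  [/\ J 0, forall x y, J x -> J y -> J (x - y)
    & forall a x b, J x -> J (a * x * b)].

Definition generated_ideal (x : A) : Prop :=
  forall J, two_sided_ideal J -> (forall r, rel r -> J r) -> J x.

Definition gideal (x : A) : bool := `[< generated_ideal x >].

Lemma gidealP : two_sided_ideal (fun x => gideal x).
Proof.
split=> [|x y /asboolP ix /asboolP iy|a x b /asboolP ix]; apply/asboolP=> J iJ rJ.
- by case: iJ.
- by case: (iJ) => _ sJ _; apply: (sJ x y); [apply: (ix J) | apply: (iy J)].
- by case: (iJ) => _ _ mJ; apply: (mJ a x b); apply: (ix J).
Qed.

Lemma gideal_zmod_closed : zmod_closed gideal.
Proof. by case: gidealP => i0 iB _; split. Qed.
HB.instance Definition _ := GRing.isZmodClosed.Build A gideal gideal_zmod_closed.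

Local Notation zquot := (@Quotient.quot A (GRing.ZmodClosed.clone A gideal _)).

Lemma gidealD x y : gideal x -> gideal y -> gideal (x + y).
Proof.
case: gidealP => i0 iB _ ix iy; rewrite -[y]opprK; apply: (iB) => //.
by rewrite -[- y]add0r; apply: (iB).
Qed.
Lemma gidealMl a x : gideal x -> gideal (a * x).
Proof. by case: gidealP => _ _ iM /(iM a _ 1); rewrite mulr1. Qed.
Lemma gidealMr a x : gideal x -> gideal (x * a).
Proof. by case: gidealP => _ _ iM /(iM 1 _ a); rewrite mul1r. Qed.

Hypothesis proper : ~ generated_ideal 1.

(* The quotient of [A] by the two-sided ideal generated by [rel]; properness
   of the ideal makes it a nonzero ring. *)
Definition quotient_algebra of ~ generated_ideal 1 : Type := zquot.

Local Notation B := (quotient_algebra proper).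

HB.instance Definition _ := GRing.Zmodule.on B.

Definition qpi (x : A) : B := \pi_zquot x.
Definition qrepr (x : B) : A := repr (x : zquot).

Lemma qreprK x : qpi (qrepr x) = x.
Proof. exact: reprK. Qed.

Lemma qpi_eq x y : (qpi x = qpi y) <-> gideal (x - y).
Proof.
have := Quotient.idealrBE (GRing.ZmodClosed.clone A gideal _) x y.
by rewrite -topredE /= /qpi => ->; split=> /eqP.
Qed.

Lemma qpiB x y : qpi (x - y) = qpi x - qpi y.
Proof. by rewrite /qpi raddfB. Qed.
Lemma qpiD x y : qpi (x + y) = qpi x + qpi y.
Proof. by rewrite /qpi raddfD. Qed.

Definition qmul (x y : B) : B := qpi (qrepr x * qrepr y).
Definition qone : B := qpi 1.
Definition qscale (k : K) (x : B) : B := qpi (k *: qrepr x).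

Lemma gideal_qrepr x : gideal (qrepr (qpi x) - x).
Proof. by apply/qpi_eq; rewrite qreprK. Qed.

Lemma qpiM x y : qmul (qpi x) (qpi y) = qpi (x * y).
Proof.
apply/qpi_eq; set x' := qrepr _; set y' := qrepr _.
have -> : x' * y' - x * y = (x' - x) * y' + x * (y' - y).
  by rewrite mulrBl mulrBr addrA subrK.
by apply: gidealD; [apply: gidealMr | apply: gidealMl]; apply: gideal_qrepr.
Qed.

Lemma qpiZ k x : qscale k (qpi x) = qpi (k *: x).
Proof.
by apply/qpi_eq; rewrite -scalerBr -mulr_algl; apply/gidealMl/gideal_qrepr.
Qed.

Lemma qind (P : B -> Prop) : (forall x, P (qpi x)) -> forall x, P x.
Proof. by move=> h x; rewrite -(qreprK x). Qed.

Lemma qmulA : associative qmul.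
Proof. by elim/qind=> x; elim/qind=> y; elim/qind=> z; rewrite !qpiM mulrA. Qed.
Lemma q1mul : left_id qone qmul.
Proof. by elim/qind=> x; rewrite qpiM mul1r. Qed.
Lemma qmul1 : right_id qone qmul.
Proof. by elim/qind=> x; rewrite qpiM mulr1. Qed.
Lemma qmulDl : left_distributive qmul +%R.
Proof.
by elim/qind=> x; elim/qind=> y; elim/qind=> z; rewrite -qpiD !qpiM -qpiD mulrDl.
Qed.
Lemma qmulDr : right_distributive qmul +%R.
Proof.
by elim/qind=> x; elim/qind=> y; elim/qind=> z; rewrite -qpiD !qpiM -qpiD mulrDr.
Qed.
Lemma qone_neq0 : qone != 0.
Proof.
apply/eqP; rewrite -[0](subrr qone) -qpiB => /qpi_eq.
by rewrite subrr subr0 => /asboolP.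
Qed.

HB.instance Definition _ := GRing.Zmodule_isNzRing.Build B
  qmulA q1mul qmul1 qmulDl qmulDr qone_neq0.

Lemma qscaleA a b v : qscale a (qscale b v) = qscale (a * b) v.
Proof. by elim/qind: v => x; rewrite !qpiZ scalerA. Qed.
Lemma q1scale : left_id 1 qscale.
Proof. by elim/qind=> x; rewrite qpiZ scale1r. Qed.
Lemma qscaleDr : right_distributive qscale +%R.
Proof.
by move=> a; elim/qind=> x; elim/qind=> y; rewrite -qpiD !qpiZ scalerDr qpiD.
Qed.
Lemma qscaleDl v : {morph qscale^~ v : a b / a + b}.
Proof. by elim/qind: v => x a b; rewrite !qpiZ scalerDl qpiD. Qed.

HB.instance Definition _ := GRing.Zmodule_isLmodule.Build K B
  qscaleA q1scale qscaleDr qscaleDl.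

Lemma q_scaleAl (k : K) (x y : B) : k *: (x * y) = (k *: x) * y.
Proof.
elim/qind: x => x; elim/qind: y => y.
by rewrite -[LHS]/(qscale k (qmul _ _)) -[RHS]/(qmul (qscale k _) _)
  !(qpiM, qpiZ) scalerAl.
Qed.
Lemma q_scaleAr (k : K) (x y : B) : k *: (x * y) = x * (k *: y).
Proof.
elim/qind: x => x; elim/qind: y => y.
by rewrite -[LHS]/(qscale k (qmul _ _)) -[RHS]/(qmul _ (qscale k _))
  !(qpiM, qpiZ) scalerAr.
Qed.

HB.instance Definition _ := GRing.Lmodule_isLalgebra.Build K B q_scaleAl.
HB.instance Definition _ := GRing.Lalgebra_isAlgebra.Build K B q_scaleAr.

End IdealQuotient.

Lemma arrow_ideal_proper (Q : quiver) (K : fieldType)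
    (rel : path_algebra Q K -> Prop) :
  (forall r, rel r -> r@_(trivial_path (base_vertex Q)) = 0) ->
  ~ generated_ideal rel 1.
Proof.
move=> rel0 /(_ (fun g => g@_(trivial_path (base_vertex Q)) = 0)) H.
have /eqP : (paone Q K)@_(trivial_path (base_vertex Q)) = 0.
  apply: H => //; split=> [|x y hx hy|a x b hx].
  - by rewrite raddf0.
  - by rewrite raddfB /= hx hy subr0.
  - by rewrite !mcoeff_trivM hx mulr0 mul0r.
by rewrite paoneE oner_eq0.
Qed.

Section LambdaAlgebra.
Variables (K : fieldType) (n : nat) (hn : (2 <= n)%N).

(* Vertices and arrow pairs are numbered from 0: the ordinal [i : 'I_n] is
   vertex [i + 1], and [j : 'I_n.-1] stands for the pair of arrows between the
   ordinals [j] and [j + 1]. *)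
Lemma lower_subproof (j : 'I_n.-1) : (j < n)%N.
Proof. exact: leq_trans (ltn_ord j) (leq_pred n). Qed.
Lemma upper_subproof (j : 'I_n.-1) : (j.+1 < n)%N.
Proof. by rewrite -ltn_predRL. Qed.
Definition lower (j : 'I_n.-1) : 'I_n := Ordinal (lower_subproof j).
Definition upper (j : 'I_n.-1) : 'I_n := Ordinal (upper_subproof j).

(* [inl j] is the arrow going up, [inr j] the arrow going down. *)
Definition zigzag_quiver : quiver := {|
  vertex := 'I_n;
  arrow := ('I_n.-1 + 'I_n.-1)%type;
  source := fun a => match a with inl j => lower j | inr j => upper j end;
  target := fun a => match a with inl j => upper j | inr j => lower j end;
  base_vertex := Ordinal (ltnW hn)
|}.

Local Notation kQ := (path_algebra zigzag_quiver K).

Definition alpha (j : 'I_n.-1) : kQ := arr K (inl j : arrow zigzag_quiver).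
Definition alpha' (j : 'I_n.-1) : kQ := arr K (inr j : arrow zigzag_quiver).

Inductive Lambda_rel : kQ -> Prop :=
| rel_up (i j : 'I_n.-1) of j = i.+1 :> nat : Lambda_rel (alpha j * alpha i)
| rel_down (i j : 'I_n.-1) of j = i.+1 :> nat : Lambda_rel (alpha' i * alpha' j)
| rel_loop (i : 'I_n.-1) : Lambda_rel (alpha i * alpha' i).

Lemma Lambda_rel_proper : ~ generated_ideal Lambda_rel 1.
Proof.
apply: (@arrow_ideal_proper zigzag_quiver K Lambda_rel) => r.
by case=> [i j _|i j _|i]; apply: mcoeff_arrM.
Qed.

Definition Lambda : algType K := quotient_algebra Lambda_rel_proper.

Definition idem (i : 'I_n) : Lambda :=
  qpi Lambda_rel_proper (vtx K (i : vertex zigzag_quiver)).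

End LambdaAlgebra.

Section Modules.
Variables (K : fieldType) (A : algType K).

(* A finite-dimensional left [A]-module: a finite-dimensional [K]-vector space
   with a unital [K]-algebra homomorphism from [A] to its endomorphisms. *)
Record fdmod := FdMod {
  carrier :> vectType K;
  act : {linear A -> 'End(carrier)};
  act1 : act 1 = \1%VF;
  actM : forall a b : A, act (a * b) = (act a \o act b)%VF
}.

Implicit Types M N X Y : fdmod.

Definition is_hom M N (f : 'Hom(M, N)) : Prop :=
  forall (a : A) (v : M), f (act M a v) = act N a (f v).

Definition is_submodule M (U : {vspace M}) : Prop :=
  forall a : A, (act M a @: U <= U)%VS.

Definition simple M : Prop :=
  (0 < \dim {:M})%N /\
  forall U : {vspace M}, is_submodule U -> U = 0%VS \/ U = fullv.

Definition indecomposable M : Prop :=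
  (0 < \dim {:M})%N /\
  forall U W : {vspace M}, is_submodule U -> is_submodule W ->
    (U + W)%VS = fullv -> (U :&: W)%VS = 0%VS -> U = 0%VS \/ W = 0%VS.

Definition short_exact X M Y (f : 'Hom(X, M)) (g : 'Hom(M, Y)) : Prop :=
  [/\ is_hom f, is_hom g, lker f = 0%VS, limg f = lker g & limg g = fullv].

(* [M] is uniserial of length two with top in [T] and socle in [S] (both given
   as isomorphism classes of simple modules): its only submodules are [0],
   a copy of [S], and [M], and the quotient by the copy of [S] is [T]. *)
Definition uniserial2 (T S : fdmod -> Prop) M : Prop :=
  exists X Y (f : 'Hom(X, M)) (g : 'Hom(M, Y)),
    [/\ S X, T Y, short_exact f g
      & forall U : {vspace M}, is_submodule U ->
          [\/ U = 0%VS, U = limg f | U = fullv]].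

(* [U' / U] is isomorphic to [X]; the linear map [p] is only required to be
   [A]-linear on [U']. *)
Definition subquotient_iso M (U U' : {vspace M}) X : Prop :=
  (U <= U')%VS /\
  exists p : 'Hom(M, X),
    [/\ forall (a : A) (v : M), v \in U' -> p (act M a v) = act X a (p v),
        (p @: U')%VS = fullv & (U' :&: lker p)%VS = U].

Definition filtered_by (C : fdmod -> Prop) M : Prop :=
  exists (t : nat) (U : nat -> {vspace M}),
    [/\ U 0%N = 0%VS, U t = fullv, forall k, (k <= t)%N -> is_submodule (U k)
      & forall k, (k < t)%N -> exists2 X, C X & subquotient_iso (U k) (U k.+1) X].

Definition projective (P : fdmod) : Prop :=
  forall M N (g : 'Hom(M, N)) (f : 'Hom(P, N)),
    is_hom g -> limg g = fullv -> is_hom f ->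
    exists2 h : 'Hom(P, M), is_hom h & (g \o h)%VF = f.

Record projective_resolution M := ProjectiveResolution {
  pres :> nat -> fdmod;
  pdiff : forall i, 'Hom(pres i.+1, pres i);
  paug : 'Hom(pres 0%N, M);
  pres_projective : forall i, projective (pres i);
  pdiff_hom : forall i, is_hom (pdiff i);
  paug_hom : is_hom paug;
  paug_surj : limg paug = fullv;
  pres_exact0 : limg (pdiff 0%N) = lker paug;
  pres_exactS : forall i, limg (pdiff i.+1) = lker (pdiff i)
}.

Definition cocycle M (P : projective_resolution M) N m (f : 'Hom(P m, N)) : Prop :=
  is_hom f /\ (f \o pdiff P m)%VF = 0.

Definition coboundary M (P : projective_resolution M) N m :
    'Hom(P m, N) -> Prop :=
  match m with
  | 0 => fun f => f = 0
  | k.+1 => fun f =>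
      exists2 g : 'Hom(P k, N), is_hom g & f = (g \o pdiff P k)%VF
  end.

(* [Ext^m(M, N) = 0]: the [m]-th cohomology of [Hom_A(P, N)] vanishes for the
   projective resolutions [P] of [M].  Up to isomorphism it does not depend on
   [P], and [P] exists as soon as [A] is finite-dimensional. *)
Definition Ext_eq0 m M N : Prop :=
  forall (P : projective_resolution M) (f : 'Hom(P m, N)),
    cocycle f -> coboundary f.

Definition self_orthogonal M : Prop :=
  forall m, (1 <= m)%N -> Ext_eq0 m M M.

End Modules.

Section StandardModules.
Variables (K : fieldType) (n : nat) (hn : (2 <= n)%N).

Notation modL := (fdmod (Lambda K hn)).

Definition is_L (i : 'I_n) (M : modL) : Prop :=
  simple M /\ act M (idem K hn i) <> 0.

Definition is_Delta (i : 'I_n) (M : modL) : Prop :=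
  (i = 0%N :> nat /\ is_L i M) \/
  exists2 j : 'I_n, i = j.+1 :> nat & uniserial2 (is_L i) (is_L j) M.

Definition is_nabla (i : 'I_n) (M : modL) : Prop :=
  (i = 0%N :> nat /\ is_L i M) \/
  exists2 j : 'I_n, i = j.+1 :> nat & uniserial2 (is_L j) (is_L i) M.

Definition F_Delta (M : modL) : Prop :=
  filtered_by (fun X => exists i, is_Delta i X) M.

Definition F_nabla (M : modL) : Prop :=
  filtered_by (fun X => exists i, is_nabla i X) M.

End StandardModules.

(* Main.v *)
Require Import Defs.
From HB Require Import structures.
From mathcomp Require Import all_boot all_order all_algebra.
From mathcomp Require Import finmap generic_quotient ring_quotient monalg boolp.

(** A module over Lambda_n is a graded space with operators A (the arrows
    [alpha]) and B (the arrows [alpha']) subject to AA = BB = AB = 0.  For every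
    module, exactness at the vertices >= 2 of the complex given by B yields a
    standard filtration, and exactness there of the complex given by A yields
    a costandard one.  So M has nonzero B-homology at some vertex 1 + q, N has
    nonzero A-homology at some vertex 1 + p (p, q >= 1), and the two classes
    combine to a nonzero element of Ext^(p+q)(M, N): it lives on the Koszul dual
    word A^p B^q, the path from 1 + q down to 1 and up to 1 + p.  Concretely,
    each syzygy moves the B-class one vertex down; once it reaches vertex 1 it
    becomes a class that each further syzygy moves one vertex up. *)

Set Implicit Arguments.
Unset Strict Implicit.
Unset Printing Implicit Defensive.

Import GRing.Theory.
Local Open Scope ring_scope.

(** * The path algebra and its generators *)

(** Exactness is asked only from vertex 2 on because the two-dimensional standard modules are exact
    for B and the two-dimensional costandard ones for A, whereas [L(1)], which is both standard and
    costandard, has homology at vertex 1. That exactness suffices is shown by working at the highest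
    vertex: nothing arrives there from above, so a costandard quotient or a standard submodule can
    be split off, and exactness passes to the rest. The syzygies are those of the free cover Lambda
    tensor M over K, which is large but explicit in coordinates indexed by paths. A homology class
    is carried as a cycle together with a functional that vanishes on boundaries; both have explicit
    images in the syzygy. The obstacle is the product BA, the only product of two arrows that
    survives: it is why the functional of [homB_syz] and the homomorphism of [homAtop_obstruction]
    need a second summand on the coordinates of the paths [alpha'_j alpha_j]. As [Ext_eq0] speaks of
    all projective resolutions, refuting it for this one is enough. *)

Lemma malg_ind (K : fieldType) (T : choiceType) (P : {malg K[T]} -> Prop) :
  (forall k x y, P x -> P y -> P (k *: x + y)) -> P 0 ->
  (forall t, P << t >>) -> forall x, P x.
Proof.
move=> PD P0 Pb x; rewrite [x]monalgE; elim/big_ind: _ => // [y z Py Pz|t _].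
  by rewrite -[y]scale1r; apply: PD.
have -> : << x@_t *g t >> = x@_t *: << t >> :> {malg K[T]}.
  by apply/malgP => u; rewrite mcoeffZ !mcoeffU mulrnAr mulr1.
by rewrite -[_ *: _]addr0; apply: PD.
Qed.

Section PathBasis.
Variables (K : fieldType) (Q : quiver).
Local Notation kQ := (path_algebra Q K).

(** The induction removes the last arrow traversed, because that arrow is the left factor of the
    path and left modules let it act last. *)
Lemma pbasis_ind (P : kQ -> Prop) :
  (forall x, P (vtx K x)) ->
  (forall a x, P x -> P (arr K a * x)) ->
  forall p, P (pbasis K p).
Proof.
move=> Pv Pa [[x s] ps]; elim/last_ind: s => [|s a IH] in ps *.
  have -> : QPath ps = trivial_path x by exact: val_inj.
  exact: Pv.
have /andP[ps' /andP[/eqP sa _]] : is_qpath x s && is_qpath (qend x s) [:: a].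
  by rewrite -is_qpath_cat cats1; exact: ps.
have := Pa a _ (IH ps'); congr P.
rewrite -[_ * _]/(pamul (pbasis K _) (pbasis K _)) pamulbb.
set q := QPath _.
have [|r -> [r1 r2 r3]] := @pcompP _ (arrow_path a) q.
  by rewrite -[RHS]/(source a) sa.
congr pbasis; apply/val_inj/eqP; rewrite -pair_eqE /=.
by rewrite -/(pstart r) -/(parrows r) r1 r3 /= cats1 !eqxx.
Qed.

End PathBasis.

Section Generators.
Variables (K : fieldType) (n : nat) (hn : (2 <= n)%N).
Local Notation L := (Lambda K hn).
Local Notation pr := (Lambda_rel_proper (K := K) (hn := hn)).
Local Notation pi := (qpi pr).

Definition up (j : 'I_n.-1) : L := pi (alpha K hn j).
Definition dn (j : 'I_n.-1) : L := pi (alpha' K hn j).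

Lemma piM x y : pi (x * y) = (pi x : L) * pi y.
Proof. by symmetry; exact: qpiM. Qed.

Lemma piZ k x : pi (k *: x) = k *: (pi x : L).
Proof. by symmetry; exact: qpiZ. Qed.

Lemma pi0 : pi 0 = 0. Proof. by rewrite /qpi raddf0. Qed.

(** Reduces to the generators all later checks that a map is a homomorphism or that a subspace is a
    submodule. *)
Lemma Lambda_ind (P : L -> Prop) :
  (forall k x y, P x -> P y -> P (k *: x + y)) ->
  (forall i, P (idem K hn i)) ->
  (forall j x, P x -> P (up j * x)) ->
  (forall j x, P x -> P (dn j * x)) ->
  forall x, P x.
Proof.
move=> PD Pe Pu Pd; apply: qind; apply: malg_ind => [k x y Px Py||].
  by have := PD k _ _ Px Py; rewrite -piZ -qpiD.
  (* [P 0] is not among the premises; it is obtained from [-e + e] with [e] the first idempotent. *)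
  have := PD (-1) _ _ (Pe (Ordinal (ltnW hn))) (Pe (Ordinal (ltnW hn))).
  by rewrite scaleN1r addNr -pi0.
apply: (@pbasis_ind K (zigzag_quiver hn) (fun x => P (pi x))) =>
  [i|[] j x Px]; first exact: Pe.
  by rewrite piM; apply: Pu.
by rewrite piM; apply: Pd.
Qed.

Lemma vtx_vtx (Q : quiver) (x y : vertex Q) :
  vtx K x * vtx K y = if x == y then vtx K x else 0.
Proof.
rewrite -[_ * _]/(pamul (pbasis K _) (pbasis K _)) pamulbb triv_pcomp.
by case: (eqVneq x y) => [->|]; rewrite ?eqxx // => /negPf; rewrite /pend /= => ->.
Qed.

Lemma vtx_arr (Q : quiver) (x : vertex Q) a :
  vtx K x * arr K a = if x == target a then arr K a else 0.
Proof.
rewrite -[_ * _]/(pamul (pbasis K _) (pbasis K _)) pamulbb triv_pcomp.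
by case: eqP.
Qed.

Lemma arr_vtx (Q : quiver) (x : vertex Q) a :
  arr K a * vtx K x = if x == source a then arr K a else 0.
Proof.
rewrite -[_ * _]/(pamul (pbasis K _) (pbasis K _)) pamulbb pcomp_triv.
by case: eqP.
Qed.

Lemma idem_idem i j :
  idem K hn i * idem K hn j = if i == j then idem K hn i else 0.
Proof. by rewrite -piM vtx_vtx (fun_if pi) pi0. Qed.

Lemma sum_idem : \sum_i idem K hn i = 1.
Proof. by rewrite /idem /qpi -raddf_sum. Qed.

Lemma idem_up i j : idem K hn i * up j = if i == upper j then up j else 0.
Proof. by rewrite -piM vtx_arr (fun_if pi) pi0. Qed.
Lemma up_idem i j : up j * idem K hn i = if i == lower j then up j else 0.
Proof. by rewrite -piM arr_vtx (fun_if pi) pi0. Qed.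
Lemma idem_dn i j : idem K hn i * dn j = if i == lower j then dn j else 0.
Proof. by rewrite -piM vtx_arr (fun_if pi) pi0. Qed.
Lemma dn_idem i j : dn j * idem K hn i = if i == upper j then dn j else 0.
Proof. by rewrite -piM arr_vtx (fun_if pi) pi0. Qed.

Lemma pi_rel r : Lambda_rel r -> pi r = 0.
Proof.
move=> rr; rewrite -pi0; apply/qpi_eq; rewrite subr0.
by apply/asboolP => J _; apply.
Qed.

(** For arrows whose endpoints do not match: the idempotents between the two factors are orthogonal.
    This frees the zero relations below from conditions on the indices. *)
Lemma mul_ortho (R : pzRingType) (x y e f : R) :
  x * e = x -> f * y = y -> e * f = 0 -> x * y = 0.
Proof. by move=> <- <- ef; rewrite mulrA -(mulrA x) ef mulr0 mul0r. Qed.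

Lemma up_up i j : up j * up i = 0.
Proof.
have [e|ne] := eqVneq (lower j) (upper i).
  by rewrite -piM pi_rel //; apply: rel_up; exact: (congr1 val e).
have := up_idem (lower j) j; have := idem_up (upper i) i.
have := idem_idem (lower j) (upper i); rewrite !eqxx (negPf ne).
by move=> e1 e2 e3; apply: (mul_ortho e3 e2 e1).
Qed.

Lemma dn_dn i j : dn i * dn j = 0.
Proof.
have [e|ne] := eqVneq (upper i) (lower j).
  by rewrite -piM pi_rel //; apply: rel_down; exact: (esym (congr1 val e)).
have := dn_idem (upper i) i; have := idem_dn (lower j) j.
have := idem_idem (upper i) (lower j); rewrite !eqxx (negPf ne).
by move=> e1 e2 e3; apply: (mul_ortho e3 e2 e1).
Qed.

Lemma lower_inj : injective (@lower n).
Proof. by move=> i j /(congr1 val) /= /val_inj. Qed.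
Lemma upper_inj : injective (@upper n).
Proof. by move=> i j /(congr1 val) /= [] /val_inj. Qed.

Lemma up_dn i j : up i * dn j = 0.
Proof.
have [<-|ne] := eqVneq i j; first by rewrite -piM pi_rel //; apply: rel_loop.
have := up_idem (lower i) i; have := idem_dn (lower j) j.
have := idem_idem (lower i) (lower j).
rewrite !eqxx (inj_eq lower_inj) (negPf ne).
by move=> e1 e2 e3; apply: (mul_ortho e3 e2 e1).
Qed.

End Generators.

(** * Modules from representations of the quiver *)

Section QuiverRepresentation.
Variables (K : fieldType) (Q : quiver) (V : vectType K).
Variables (e : vertex Q -> 'End(V)) (g : arrow Q -> 'End(V)).
Hypothesis ee : forall x y, (e x \o e y)%VF = if x == y then e x else 0.
Hypothesis e1 : \sum_x e x = \1%VF.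
Hypothesis eg : forall a, (e (target a) \o g a)%VF = g a.
Hypothesis ge : forall a, (g a \o e (source a))%VF = g a.

Definition seq_op (f : 'End(V)) (s : seq (arrow Q)) : 'End(V) :=
  foldl (fun h a => g a \o h)%VF f s.
Definition path_op (p : qpath Q) : 'End(V) := seq_op (e (pstart p)) (parrows p).
Definition pa_op (x : path_algebra Q K) : 'End(V) := lext path_op x.

Lemma pa_op_linear : linear pa_op.
Proof. exact: lext_linear. Qed.

Lemma pa_op_basis p : pa_op (pbasis K p) = path_op p.
Proof. exact: lextU. Qed.

Lemma seq_op_comp f h s : seq_op (f \o h) s = (seq_op f s \o h)%VF.
Proof. by elim: s f => //= a s IH f; rewrite comp_lfunA IH. Qed.

Lemma seq_op_end x s : is_qpath x s ->
  (e (qend x s) \o seq_op (e x) s)%VF = seq_op (e x) s.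
Proof.
elim/last_ind: s => [|s a _]; first by rewrite /qend /= ee eqxx.
move=> _; rewrite /seq_op foldl_rcons /qend map_rcons last_rcons.
by rewrite comp_lfunA eg.
Qed.

Lemma path_op_end p : (e (pend p) \o path_op p)%VF = path_op p.
Proof. exact: seq_op_end (valP p). Qed.

Lemma path_op_start p : (path_op p \o e (pstart p))%VF = path_op p.
Proof. by rewrite /path_op -seq_op_comp ee eqxx. Qed.

(** If the paths do not meet, the idempotents at the end of [q] and at the start of [p] are
    orthogonal, which agrees with the value 0 for [None]. *)
Lemma path_op_cat p q : oapp path_op 0 (Defs.pcomp p q) = (path_op p \o path_op q)%VF.
Proof.
have [epq|npq] := eqVneq (pend q) (pstart p).
  have [r -> [r1 _ r3]] /= := pcompP epq.
  rewrite -[in RHS](path_op_end q) {2}/path_op comp_lfunA -[in RHS]comp_lfunA.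
  rewrite path_op_end /path_op r1 r3 {1}/seq_op foldl_cat -/(seq_op _ _).
  rewrite -/(seq_op _ _) -/(path_op q) -[in LHS](path_op_end q) epq.
  exact: seq_op_comp.
rewrite pcompN /=; last exact/eqP.
rewrite -(path_op_end q) -(path_op_start p) comp_lfunA -(comp_lfunA (path_op p)).
by rewrite ee eq_sym (negPf npq) comp_lfun0r comp_lfun0l.
Qed.

Lemma pa_op1 : pa_op 1 = \1%VF.
Proof.
rewrite -e1 -[1]/(paone Q K) /paone.
pose h := GRing.isLinear.Build _ _ _ _ _ pa_op_linear.
pose F : {linear _ -> _} := HB.pack pa_op h.
rewrite -[LHS]/(F _) linear_sum; apply: eq_bigr => x _.
by rewrite /F /= pa_op_basis.
Qed.

Lemma pa_op0 : pa_op 0 = 0.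
Proof. by have := pa_op_linear (-1) 0 0; rewrite !scaleN1r !addNr. Qed.

Lemma pa_opMbasis p q :
  pa_op (pbasis K p * pbasis K q) = (path_op p \o path_op q)%VF.
Proof.
have -> : pbasis K p * pbasis K q = obasis K (Defs.pcomp p q).
  exact: pamulbb.
rewrite -path_op_cat; case: (Defs.pcomp p q) => [r|] /=; [exact: pa_op_basis | exact: pa_op0].
Qed.

Lemma pa_opM x y : pa_op (x * y) = (pa_op x \o pa_op y)%VF.
Proof.
move: x; apply: (linear_malg_eq (V := 'End(V))).
- by move=> k u v; rewrite -[_ * y]/(pamul _ y) pamulDl pa_op_linear.
- by move=> k u v; rewrite pa_op_linear comp_lfunDl comp_lfunZl.
move=> p; move: y; apply: (linear_malg_eq (V := 'End(V))).
- by move=> k u v; rewrite -[_ * _]/(pamul _ _) pamulDr pa_op_linear.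
- by move=> k u v; rewrite pa_op_linear comp_lfunDr comp_lfunZr.
move=> q; apply: etrans (pa_opMbasis p q) _.
by congr (_ \o _)%VF; symmetry; apply: pa_op_basis.
Qed.

Lemma pa_op_arr a : pa_op (arr K a) = g a.
Proof. by rewrite pa_op_basis /path_op /seq_op /= ge. Qed.

Lemma pa_op_vtx x : pa_op (vtx K x) = e x.
Proof. by rewrite pa_op_basis. Qed.

End QuiverRepresentation.

Section LambdaRepresentation.
Variables (K : fieldType) (n : nat) (hn : (2 <= n)%N).
Local Notation L := (Lambda K hn).
Local Notation pr := (Lambda_rel_proper (K := K) (hn := hn)).

(* The operators are not composable as paths unless the indices match, but then
   the products vanish as well, so the relations can be stated for all indices. *)
Record lrep (V : vectType K) := LRep {
  rE : 'I_n -> 'End(V);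
  rA : 'I_n.-1 -> 'End(V);
  rB : 'I_n.-1 -> 'End(V);
  rEE : forall i j, (rE i \o rE j)%VF = if i == j then rE i else 0;
  rE1 : \sum_i rE i = \1%VF;
  rEA : forall j, (rE (upper j) \o rA j)%VF = rA j;
  rAE : forall j, (rA j \o rE (lower j))%VF = rA j;
  rEB : forall j, (rE (lower j) \o rB j)%VF = rB j;
  rBE : forall j, (rB j \o rE (upper j))%VF = rB j;
  rAA : forall i j, (rA j \o rA i)%VF = 0;
  rBB : forall i j, (rB j \o rB i)%VF = 0;
  rAB : forall i j, (rA j \o rB i)%VF = 0
}.

Variables (V : vectType K) (r : lrep V).

Definition rgen (a : arrow (zigzag_quiver hn)) : 'End(V) :=
  match a with inl j => rA r j | inr j => rB r j end.
Local Notation op := (@pa_op K (zigzag_quiver hn) V (rE r) rgen).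

Lemma rgen_target (a : arrow (zigzag_quiver hn)) :
  (rE r (target a) \o rgen a)%VF = rgen a.
Proof. by case: a => j; [exact: rEA | exact: rEB]. Qed.
Lemma rgen_source (a : arrow (zigzag_quiver hn)) :
  (rgen a \o rE r (source a))%VF = rgen a.
Proof. by case: a => j; [exact: rAE | exact: rBE]. Qed.

Let opM := pa_opM (Q := zigzag_quiver hn) (rEE r) rgen_target.
Let op_arr := pa_op_arr (Q := zigzag_quiver hn) rgen_source.

Lemma opMarr a b : op (arr K a * arr K b) = (rgen a \o rgen b)%VF.
Proof. by apply: etrans (opM _ _) _; congr (_ \o _)%VF; apply: op_arr. Qed.

(** The elements that act by zero form a two-sided ideal containing the relations. Hence the
    representative chosen in [rep_act] does not matter. *)
Lemma op_gideal x : gideal (@Lambda_rel K n hn) x -> op x = 0.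
Proof.
move/asboolP/(_ (fun x => op x = 0)); apply=> [|_ [i j _|i j _|i]].
- split=> [|u v hu hv|u v w hv]; first exact: pa_op0.
    by rewrite -[u - v]addrC -scaleN1r pa_op_linear hu hv addr0 scaler0.
  by rewrite !opM hv comp_lfun0r comp_lfun0l.
- exact: etrans (opMarr (inl j) (inl i)) (rAA r i j).
- exact: etrans (opMarr (inr i) (inr j)) (rBB r j i).
- exact: etrans (opMarr (inl i) (inr i)) (rAB r i i).
Qed.

Definition rep_act (x : L) : 'End(V) := op (qrepr x).

Lemma rep_act_pi x : rep_act (qpi pr x) = op x.
Proof.
have : op (qrepr (qpi pr x) - x) = 0 by apply/op_gideal/gideal_qrepr.
rewrite -[_ - x]addrC -scaleN1r pa_op_linear scaleN1r addrC.
by move/eqP; rewrite subr_eq0 => /eqP.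
Qed.

Lemma rep_act_linear : linear rep_act.
Proof.
move=> k; apply: qind => x; apply: qind => y.
by rewrite -piZ -qpiD !rep_act_pi pa_op_linear.
Qed.

Definition rep_lin : {linear L -> 'End(V)} :=
  HB.pack rep_act (GRing.isLinear.Build _ _ _ _ _ rep_act_linear).

Lemma rep_act1 : rep_lin 1 = \1%VF.
Proof. by rewrite /= -[1]/(qpi pr 1) rep_act_pi pa_op1 // rE1. Qed.

Lemma rep_actM x y : rep_lin (x * y) = (rep_lin x \o rep_lin y)%VF.
Proof.
move: x y; apply: qind => x; apply: qind => y.
by rewrite /= -piM !rep_act_pi opM.
Qed.

Definition rep_mod : fdmod L := FdMod rep_act1 rep_actM.

Lemma rep_mod_idem i : act rep_mod (idem K hn i) = rE r i.
Proof. by rewrite /= rep_act_pi pa_op_vtx. Qed.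
Lemma rep_mod_up j : act rep_mod (up K hn j) = rA r j.
Proof. by rewrite /= rep_act_pi op_arr. Qed.
Lemma rep_mod_dn j : act rep_mod (dn K hn j) = rB r j.
Proof. by rewrite /= rep_act_pi op_arr. Qed.

End LambdaRepresentation.

(** * Submodules and the operators of a module *)

Section Submodule.
Variables (K : fieldType) (A : algType K) (M : fdmod A) (U : {vspace M}).
Hypothesis subU : is_submodule U.

(** The projection [vsproj] only gives the value its type: on a submodule it meets vectors that
    already lie in [U]. *)
Definition sub_act (a : A) : 'End(subvs_of U) :=
  (linfun (vsproj U) \o (act M a \o linfun vsval))%VF.

Lemma sub_act_linear : linear sub_act.
Proof.
move=> k a b; rewrite /sub_act linearP comp_lfunDl -comp_lfunZl.
by rewrite comp_lfunDr -comp_lfunZr.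
Qed.

Definition sub_lin : {linear A -> 'End(subvs_of U)} :=
  HB.pack sub_act (GRing.isLinear.Build _ _ _ _ _ sub_act_linear).

Lemma val_sub_lin a x : vsval (sub_lin a x) = act M a (vsval x).
Proof.
rewrite /= /sub_act !comp_lfunE !lfunE /= vsprojK //.
by apply: (subvP (subU a)); apply/memv_img/subvsP.
Qed.

Lemma sub_act1 : sub_lin 1 = \1%VF.
Proof. by apply/lfunP => x; apply: subvs_inj; rewrite val_sub_lin act1 !id_lfunE. Qed.

Lemma sub_actM a b : sub_lin (a * b) = (sub_lin a \o sub_lin b)%VF.
Proof.
apply/lfunP => x; apply: subvs_inj.
rewrite val_sub_lin actM comp_lfunE -!val_sub_lin.
by rewrite -[in LHS](comp_lfunE (sub_lin a) (sub_lin b)).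
Qed.

Definition submod : fdmod A := FdMod sub_act1 sub_actM.

Lemma val_submod a (x : submod) : vsval (act submod a x) = act M a (vsval x).
Proof. exact: val_sub_lin. Qed.

End Submodule.

Lemma kernel_submodule (K : fieldType) (A : algType K) (M N : fdmod A)
  (f : 'Hom(M, N)) : is_hom f -> is_submodule (lker f).
Proof.
move=> hf a; apply/subvP => _ /memv_imgP[x fx ->].
by move: fx; rewrite !memv_ker hf => /eqP->; rewrite linear0.
Qed.

(* Locked: comparing two different generators of Lambda by conversion unfolds
   the quotient algebra and does not terminate in practice. *)
HB.lock Definition mE (K : fieldType) n (hn : (2 <= n)%N)
  (M : fdmod (Lambda K hn)) i : 'End(M) := act M (idem K hn i).
HB.lock Definition mA (K : fieldType) n (hn : (2 <= n)%N)
  (M : fdmod (Lambda K hn)) j : 'End(M) := act M (up K hn j).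
HB.lock Definition mB (K : fieldType) n (hn : (2 <= n)%N)
  (M : fdmod (Lambda K hn)) j : 'End(M) := act M (dn K hn j).

Section LambdaModules.
Variables (K : fieldType) (n : nat) (hn : (2 <= n)%N).
Implicit Types M N : fdmod (Lambda K hn).


Section Relations.
Variable M : fdmod (Lambda K hn).
Implicit Types (v : M) (i k : 'I_n) (j : 'I_n.-1).

Lemma act_if b x v : act M (if b then x else 0) v = if b then act M x v else 0.
Proof. by case: b; rewrite // linear0 zero_lfunE. Qed.

Lemma act_comp a b v : act M a (act M b v) = act M (a * b) v.
Proof. by rewrite actM comp_lfunE. Qed.

Lemma mEE i k v : mE M i (mE M k v) = if i == k then mE M i v else 0.
Proof. by rewrite mE.unlock [LHS]act_comp idem_idem act_if. Qed.
Lemma mE_sum v : \sum_i mE M i v = v.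
Proof.
by rewrite mE.unlock -sum_lfunE -linear_sum sum_idem act1 id_lfunE.
Qed.
Lemma mEA i j v : mE M i (mA M j v) = if i == upper j then mA M j v else 0.
Proof. by rewrite mE.unlock mA.unlock [LHS]act_comp idem_up act_if. Qed.
Lemma mAE i j v : mA M j (mE M i v) = if i == lower j then mA M j v else 0.
Proof. by rewrite mE.unlock mA.unlock [LHS]act_comp up_idem act_if. Qed.
Lemma mEB i j v : mE M i (mB M j v) = if i == lower j then mB M j v else 0.
Proof. by rewrite mE.unlock mB.unlock [LHS]act_comp idem_dn act_if. Qed.
Lemma mBE i j v : mB M j (mE M i v) = if i == upper j then mB M j v else 0.
Proof. by rewrite mE.unlock mB.unlock [LHS]act_comp dn_idem act_if. Qed.
Lemma mAA j j' v : mA M j (mA M j' v) = 0.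
Proof. by rewrite mA.unlock [LHS]act_comp up_up linear0 zero_lfunE. Qed.
Lemma mBB j j' v : mB M j (mB M j' v) = 0.
Proof. by rewrite mB.unlock [LHS]act_comp dn_dn linear0 zero_lfunE. Qed.
Lemma mAB j j' v : mA M j (mB M j' v) = 0.
Proof. by rewrite mA.unlock mB.unlock [LHS]act_comp up_dn linear0 zero_lfunE. Qed.
End Relations.

Lemma is_homP M N (f : 'Hom(M, N)) :
  (forall i v, f (mE M i v) = mE N i (f v)) ->
  (forall j v, f (mA M j v) = mA N j (f v)) ->
  (forall j v, f (mB M j v) = mB N j (f v)) -> is_hom f.
Proof.
rewrite mE.unlock mA.unlock mB.unlock => fE fA fB.
apply: Lambda_ind => [k x y hx hy|i|j x hx|j x hx] v.
- rewrite (linearP (act M)) (linearP (act N)) !add_lfunE !scale_lfunE.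
  by rewrite linearD linearZ /= hx hy.
- exact: fE.
- by rewrite -!act_comp -hx; exact: fA.
- by rewrite -!act_comp -hx; exact: fB.
Qed.

Lemma is_submoduleP M (U : {vspace M}) :
  (forall i v, v \in U -> mE M i v \in U) ->
  (forall j v, v \in U -> mA M j v \in U) ->
  (forall j v, v \in U -> mB M j v \in U) -> is_submodule U.
Proof.
rewrite mE.unlock mA.unlock mB.unlock => UE UA UB a; apply/subvP => _ /memv_imgP[v vU ->].
move: a v vU; apply: Lambda_ind => [k x y hx hy|i|j x hx|j x hx] v vU.
- by rewrite linearP add_lfunE scale_lfunE memvD ?memvZ ?hx ?hy.
- exact: UE.
- by rewrite -act_comp; apply/UA/hx.
- by rewrite -act_comp; apply/UB/hx.
Qed.

Lemma submoduleE M (U : {vspace M}) a v :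
  is_submodule U -> v \in U -> act M a v \in U.
Proof. by move=> sU vU; apply: (subvP (sU a)); apply: memv_img. Qed.

Lemma submodule_mE M (U : {vspace M}) k v :
  is_submodule U -> v \in U -> mE M k v \in U.
Proof. by rewrite mE.unlock; apply: submoduleE. Qed.
Lemma submodule_mA M (U : {vspace M}) k v :
  is_submodule U -> v \in U -> mA M k v \in U.
Proof. by rewrite mA.unlock; apply: submoduleE. Qed.
Lemma submodule_mB M (U : {vspace M}) k v :
  is_submodule U -> v \in U -> mB M k v \in U.
Proof. by rewrite mB.unlock; apply: submoduleE. Qed.

Section OfRepresentation.
Variables (V : vectType K) (r : lrep n V).
Lemma mE_rep i : mE (rep_mod hn r) i = rE r i.
Proof. rewrite mE.unlock; exact: rep_mod_idem. Qed.
Lemma mA_rep j : mA (rep_mod hn r) j = rA r j.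
Proof. rewrite mA.unlock; exact: rep_mod_up. Qed.
Lemma mB_rep j : mB (rep_mod hn r) j = rB r j.
Proof. rewrite mB.unlock; exact: rep_mod_dn. Qed.
End OfRepresentation.

End LambdaModules.

(** * Free modules *)

Section LinearMaps.
Variables (K : fieldType) (U V : vectType K) (f : U -> V) (lf : linear f).
Definition lin_of : {linear U -> V} :=
  HB.pack f (GRing.isLinear.Build _ _ _ _ f lf).
Definition lfun_of : 'Hom(U, V) := linfun lin_of.
Lemma lfun_ofE x : lfun_of x = f x.
Proof. by rewrite lfunE. Qed.
End LinearMaps.

(* [linear_sum] would leave the canonical linear structure of [f] in the goal,
   where later rewrites do not recognise [f]. *)
Lemma lfun_sum (K : fieldType) (U V : vectType K) (f : 'Hom(U, V))
    (I : finType) (F : I -> U) : f (\sum_i F i) = \sum_i f (F i).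
Proof. exact: linear_sum. Qed.

Section FreeModule.
Variables (K : fieldType) (n : nat) (hn : (2 <= n)%N) (V : vectType K).
Local Notation m := n.-1.

(* The basis of Lambda: the trivial paths, the arrows [alpha_j], the arrows
   [alpha'_j] and the paths [alpha'_j alpha_j]. *)
Definition bpath : finType := (('I_n + 'I_m) + ('I_m + 'I_m))%type.
Definition pe (i : 'I_n) : bpath := inl (inl i).
Definition pa (j : 'I_m) : bpath := inl (inr j).
Definition pb (j : 'I_m) : bpath := inr (inl j).
Definition pc (j : 'I_m) : bpath := inr (inr j).

Definition psource (s : bpath) : 'I_n :=
  match s with
  | inl (inl i) => i | inl (inr j) => lower j
  | inr (inl j) => upper j | inr (inr j) => lower j
  end.
Definition ptarget (s : bpath) : 'I_n :=
  match s with
  | inl (inl i) => i | inl (inr j) => upper j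
  | inr (inl j) => lower j | inr (inr j) => lower j
  end.

(** A function [x] stands for the sum over [s] of the path [s] tensor [x s], an element of Lambda
    tensor V; the three maps are left multiplication by an idempotent and by the two kinds of
    arrows. *)
Definition fE_fun i (x : {ffun bpath -> V}) : {ffun bpath -> V} :=
  [ffun s => if i == ptarget s then x s else 0].
Definition fA_fun j (x : {ffun bpath -> V}) : {ffun bpath -> V} :=
  [ffun s => match s with
    | inl (inr k) => if k == j then x (pe (lower j)) else 0
    | _ => 0 end].
Definition fB_fun j (x : {ffun bpath -> V}) : {ffun bpath -> V} :=
  [ffun s => match s with
    | inr (inl k) => if k == j then x (pe (upper j)) else 0
    | inr (inr k) => if k == j then x (pa j) else 0
    | _ => 0 end].

Lemma fE_linear i : linear (fE_fun i).
Proof.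
move=> k x y; apply/ffunP => s; rewrite !ffunE.
by case: eqP; rewrite ?scaler0 ?addr0.
Qed.
Lemma fA_linear j : linear (fA_fun j).
Proof.
move=> k x y; apply/ffunP => -[[i|i]|[i|i]]; rewrite !ffunE ?scaler0 ?addr0 //.
by case: eqP; rewrite ?scaler0 ?addr0.
Qed.
Lemma fB_linear j : linear (fB_fun j).
Proof.
move=> k x y; apply/ffunP => -[[i|i]|[i|i]]; rewrite !ffunE ?scaler0 ?addr0 //.
  by case: eqP; rewrite ?scaler0 ?addr0.
by case: eqP; rewrite ?scaler0 ?addr0.
Qed.

Definition fE i := lfun_of (@fE_linear i).
Definition fA j := lfun_of (@fA_linear j).
Definition fB j := lfun_of (@fB_linear j).

Lemma fEE i k : (fE i \o fE k)%VF = if i == k then fE i else 0.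
Proof.
apply/lfunP => x; rewrite comp_lfunE (fun_if (fun f : 'End(_) => f x)) zero_lfunE.
rewrite !lfun_ofE; apply/ffunP => s; rewrite (fun_if (fun f : {ffun _} => f s)).
by rewrite !ffunE; case: (eqVneq i k) => [->|ne]; case: eqP => // <-;
  rewrite ?eqxx // eq_sym (negPf ne).
Qed.
Lemma fE1 : \sum_i fE i = \1%VF.
Proof.
apply/lfunP => x; rewrite sum_lfunE id_lfunE; apply/ffunP => s.
rewrite sum_ffunE (bigD1 (ptarget s)) //= lfun_ofE ffunE eqxx big1 ?addr0 // => i ne.
by rewrite lfun_ofE ffunE (negPf ne).
Qed.
Lemma fEA j : (fE (upper j) \o fA j)%VF = fA j.
Proof.
apply/lfunP => x; rewrite comp_lfunE !lfun_ofE.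
apply/ffunP => -[[i|i]|[i|i]]; rewrite !ffunE ?if_same //=.
by case: (eqVneq i j) => [->|]; rewrite ?eqxx ?if_same.
Qed.
Lemma fAE j : (fA j \o fE (lower j))%VF = fA j.
Proof.
apply/lfunP => x; rewrite comp_lfunE !lfun_ofE.
by apply/ffunP => -[[i|i]|[i|i]]; rewrite !ffunE //= eqxx.
Qed.
Lemma fEB j : (fE (lower j) \o fB j)%VF = fB j.
Proof.
apply/lfunP => x; rewrite comp_lfunE !lfun_ofE.
by apply/ffunP => -[[i|i]|[i|i]]; rewrite !ffunE ?if_same //=;
  case: (eqVneq i j) => [->|]; rewrite ?eqxx ?if_same.
Qed.
Lemma fBE j : (fB j \o fE (upper j))%VF = fB j.
Proof.
apply/lfunP => x; rewrite comp_lfunE !lfun_ofE.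
by apply/ffunP => -[[i|i]|[i|i]]; rewrite !ffunE //= eqxx.
Qed.
Lemma fAA j k : (fA k \o fA j)%VF = 0.
Proof.
apply/lfunP => x; rewrite comp_lfunE zero_lfunE !lfun_ofE.
by apply/ffunP => -[[i|i]|[i|i]]; rewrite !ffunE //= if_same.
Qed.
Lemma fBB j k : (fB k \o fB j)%VF = 0.
Proof.
apply/lfunP => x; rewrite comp_lfunE zero_lfunE !lfun_ofE.
by apply/ffunP => -[[i|i]|[i|i]]; rewrite !ffunE //= if_same.
Qed.
Lemma fAB j k : (fA k \o fB j)%VF = 0.
Proof.
apply/lfunP => x; rewrite comp_lfunE zero_lfunE !lfun_ofE.
by apply/ffunP => -[[i|i]|[i|i]]; rewrite !ffunE //= if_same.
Qed.

Definition free_rep : lrep n {ffun bpath -> V} :=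
  LRep fEE fE1 fEA fAE fEB fBE fAA fBB fAB.

Definition free_mod : fdmod (Lambda K hn) := rep_mod hn free_rep.
Implicit Types (x : free_mod).

Definition fcoord x s : V := (x : {ffun bpath -> V}) s.

Lemma free_ext x y : (forall s, fcoord x s = fcoord y s) -> x = y.
Proof. by move=> xy; apply/ffunP. Qed.

Lemma coordE i x s :
  fcoord (mE free_mod i x) s = if i == ptarget s then fcoord x s else 0.
Proof. by rewrite mE_rep /fcoord lfun_ofE ffunE. Qed.

Lemma coordA j x s : fcoord (mA free_mod j x) s =
  if s == pa j then fcoord x (pe (lower j)) else 0.
Proof. by rewrite mA_rep /fcoord lfun_ofE ffunE; case: s => [[]|[]]. Qed.

Lemma coordB j x s : fcoord (mB free_mod j x) s =
  if s == pb j then fcoord x (pe (upper j))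
  else if s == pc j then fcoord x (pa j) else 0.
Proof. by rewrite mB_rep /fcoord lfun_ofE ffunE; case: s => [[]|[]]. Qed.

Lemma coord_linear s : linear (fcoord^~ s).
Proof. by move=> k x y; rewrite /fcoord !ffunE. Qed.

Definition coordf s : 'Hom(free_mod, V) := lfun_of (@coord_linear s).
Lemma coordfE s x : coordf s x = fcoord x s.
Proof. exact: lfun_ofE. Qed.

Definition pin_fun s (v : V) : free_mod :=
  ([ffun t => if t == s then v else 0] : {ffun bpath -> V}).
Lemma pin_linear s : linear (pin_fun s).
Proof.
move=> k v w; apply/ffunP => t; rewrite !ffunE.
by case: eqP; rewrite ?scaler0 ?addr0.
Qed.
Definition pin s : 'Hom(V, free_mod) := lfun_of (@pin_linear s).
Lemma coord_pin s v t : fcoord (pin s v) t = if t == s then v else 0.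
Proof. by rewrite lfun_ofE /fcoord ffunE. Qed.

Lemma free_sum x : x = \sum_s pin s (fcoord x s).
Proof.
apply: free_ext => t; rewrite -[RHS]coordfE lfun_sum (bigD1 t) //=.
rewrite coordfE coord_pin eqxx big1 ?addr0 // => s ne.
by rewrite coordfE coord_pin eq_sym (negPf ne).
Qed.

Lemma mA_pin j v : mA free_mod j (pin (pe (lower j)) v) = pin (pa j) v.
Proof. by apply: free_ext => s; rewrite coordA !coord_pin eqxx. Qed.
Lemma mB_pin j v : mB free_mod j (pin (pe (upper j)) v) = pin (pb j) v.
Proof.
apply: free_ext => s; rewrite coordB !coord_pin eqxx.
by case: ifP; rewrite ?if_same.
Qed.
Lemma mB_pin_a j v : mB free_mod j (pin (pa j) v) = pin (pc j) v.
Proof.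
by apply: free_ext => s; rewrite coordB !coord_pin eqxx; case: eqP => // ->.
Qed.
Lemma mE_pin i s v :
  mE free_mod i (pin s v) = if i == ptarget s then pin s v else 0.
Proof.
apply: free_ext => t; rewrite coordE coord_pin; case: (eqVneq t s) => [->|ne].
  by case: ifP => _; rewrite /fcoord ?ffunE // -/(fcoord _ _) coord_pin eqxx.
rewrite if_same; case: ifP => _; rewrite /fcoord ?ffunE // -/(fcoord _ _).
by rewrite coord_pin (negPf ne).
Qed.

Definition pact (N : fdmod (Lambda K hn)) (s : bpath) : 'End(N) :=
  match s with
  | inl (inl i) => mE N i
  | inl (inr j) => mA N j
  | inr (inl j) => mB N j
  | inr (inr j) => (mB N j \o mA N j)%VF
  end.

(** The vectors [pin (pe i) v] generate the free module, so homomorphisms need to be compared, and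
    prescribed, only on them. *)
Lemma pact_pin s v : pact free_mod s (pin (pe (psource s)) v) = pin s v.
Proof.
case: s => [[i|j]|[j|j]] /=.
- by rewrite mE_pin eqxx.
- exact: mA_pin.
- exact: mB_pin.
- rewrite comp_lfunE; exact: etrans (congr1 _ (mA_pin j v)) (mB_pin_a j v).
Qed.

Lemma hom_mE (M N : fdmod (Lambda K hn)) (f : 'Hom(M, N)) i v :
  is_hom f -> f (mE M i v) = mE N i (f v).
Proof. by move=> hf; rewrite mE.unlock; apply: hf. Qed.
Lemma hom_mA (M N : fdmod (Lambda K hn)) (f : 'Hom(M, N)) i v :
  is_hom f -> f (mA M i v) = mA N i (f v).
Proof. by move=> hf; rewrite mA.unlock; apply: hf. Qed.
Lemma hom_mB (M N : fdmod (Lambda K hn)) (f : 'Hom(M, N)) i v :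
  is_hom f -> f (mB M i v) = mB N i (f v).
Proof. by move=> hf; rewrite mB.unlock; apply: hf. Qed.

Lemma hom_pact (M N : fdmod (Lambda K hn)) (f : 'Hom(M, N)) s v :
  is_hom f -> f (pact M s v) = pact N s (f v).
Proof.
move=> hf; case: s => [[i|j]|[j|j]] /=.
- exact: hom_mE.
- exact: hom_mA.
- exact: hom_mB.
- by rewrite !comp_lfunE hom_mB // hom_mA.
Qed.

Variable N : fdmod (Lambda K hn).

Lemma free_hom_eq (f g : 'Hom(free_mod, N)) : is_hom f -> is_hom g ->
  (forall i v, f (pin (pe i) v) = g (pin (pe i) v)) -> f = g.
Proof.
move=> hf hg fg; apply/lfunP => x; rewrite (free_sum x) !lfun_sum; apply: eq_bigr => s _.
by rewrite -pact_pin [LHS](hom_pact _ _ hf) [RHS](hom_pact _ _ hg) fg.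
Qed.

(** The values of [h i] may be arbitrary vectors of [N]: [pact N s] sees only their component at the
    source of [s]. *)
Definition fext (h : 'I_n -> 'Hom(V, N)) : 'Hom(free_mod, N) :=
  \sum_s (pact N s \o h (psource s) \o coordf s)%VF.

Lemma fextE h x : fext h x = \sum_s pact N s (h (psource s) (fcoord x s)).
Proof.
rewrite sum_lfunE; apply: eq_bigr => s _.
by rewrite !comp_lfunE coordfE.
Qed.

Lemma fext_pin h i v : fext h (pin (pe i) v) = mE N i (h i v).
Proof.
rewrite fextE (bigD1 (pe i)) //= coord_pin eqxx big1 ?addr0 // => s ne.
by rewrite coord_pin (negPf ne) !linear0.
Qed.

Lemma pactE i s v :
  mE N i (pact N s v) = if i == ptarget s then pact N s v else 0.
Proof.
case: s => [[k|k]|[k|k]]; rewrite /pact ?comp_lfunE.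
- by rewrite mEE -[ptarget _]/k; case: (eqVneq i k) => [->|].
- exact: mEA.
- exact: mEB.
- exact: mEB.
Qed.

Lemma pactA j s v :
  mA N j (pact N s v) = if s == pe (lower j) then mA N j v else 0.
Proof.
case: s => [[k|k]|[k|k]]; rewrite /pact ?comp_lfunE.
- exact: mAE.
- exact: mAA.
- exact: mAB.
- exact: mAB.
Qed.

Lemma pactB j s v :
  mB N j (pact N s v) = if s == pe (upper j) then mB N j v
                        else if s == pa j then mB N j (mA N j v) else 0.
Proof.
case: s => [[k|k]|[k|k]]; rewrite /pact ?comp_lfunE.
- by rewrite mBE -[inl (inl k) == _]/(k == upper j).
- have -> : mA N k v = mE N (upper k) (mA N k v) by rewrite mEA eqxx.
  rewrite mBE (inj_eq (@upper_inj _)).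
  by rewrite -[inl (inr k) == pa j]/(k == j); case: (eqVneq k j) => [->|].
- exact: mBB.
- exact: mBB.
Qed.

Lemma fext_hom h : is_hom (fext h).
Proof.
apply: is_homP => [i x|j x|j x]; rewrite !fextE lfun_sum.
- apply: eq_bigr => s _; rewrite coordE pactE.
  by case: ifP => _ //; rewrite !linear0.
(* [alpha_j] moves the coordinate at [pe (lower j)] to [pa j], so a single term survives on each
   side. *)
- rewrite (bigD1 (pa j)) //= coordA eqxx big1 ?addr0; last first.
    by move=> s ne; rewrite coordA (negPf ne) !linear0.
  rewrite (bigD1 (pe (lower j))) // pactA eqxx big1 => [|s ne].
    exact/esym/addr0.
  by rewrite pactA (negPf ne).
(* [alpha'_j] moves [pe (upper j)] to [pb j] and [pa j] to [pc j], so two terms survive on each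
   side. *)
- rewrite (bigD1 (pb j)) //= (bigD1 (pc j)) //= !coordB !eqxx /= big1 ?addr0.
    rewrite (bigD1 (pe (upper j))) // (bigD1 (pa j)) // !pactB !eqxx.
    rewrite big1 => [|s /andP[/negPf n1 /negPf n2]].
      by rewrite /= addr0 comp_lfunE.
    by rewrite pactB n1 n2.
  by move=> s /andP[/negPf n1 /negPf n2]; rewrite coordB n1 n2 !linear0.
Qed.

End FreeModule.
Arguments pin {K n} hn {V} s.

(** * The canonical free resolution *)

Section Homs.
Variables (K : fieldType) (A : algType K).
Implicit Types M N X : fdmod A.

Lemma comp_hom M N X (g : 'Hom(N, X)) (f : 'Hom(M, N)) :
  is_hom g -> is_hom f -> is_hom (g \o f)%VF.
Proof. by move=> hg hf a v; rewrite !comp_lfunE hf hg. Qed.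

Variables (M : fdmod A) (U : {vspace M}) (sU : is_submodule U).
Definition incl : 'Hom(submod sU, M) := linfun vsval.
Lemma inclE x : incl x = vsval x.
Proof. exact: lfunE. Qed.
Lemma incl_hom : is_hom incl.
Proof. by move=> a x; rewrite !inclE val_submod. Qed.
Lemma limg_incl : limg incl = U.
Proof.
apply/vspaceP => v; apply/memv_imgP/idP => [[x _ ->]|vU].
  by rewrite inclE subvsP.
by exists (vsproj U v); rewrite ?memvf // inclE vsprojK.
Qed.
End Homs.

Section Resolution.
Variables (K : fieldType) (n : nat) (hn : (2 <= n)%N).
Implicit Types M N : fdmod (Lambda K hn).
Local Notation free V := (free_mod hn V).

Lemma free_projective (V : vectType K) : projective (free V).
Proof.
move=> M N g f hg sg hf.
(* [g^-1] is only a linear section of [g]. Its values are used on the generators alone, and [fext]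
   makes a homomorphism of them. *)
pose h := fext (fun i => (g^-1 \o (f \o @pin K n hn V (pe i)))%VF).
exists h; first exact: fext_hom.
apply: free_hom_eq => // [|i v]; first exact: comp_hom (fext_hom _).
rewrite comp_lfunE /h fext_pin !comp_lfunE hom_mE //.
rewrite limg_lfunVK ?sg ?memvf // -hom_mE //.
by rewrite mE_pin eqxx.
Qed.

(** The action map from Lambda tensor M to M. All of [M], and not only its component at [i], is
    attached to each generator [pe i]. *)
Definition mu M : 'Hom(free M, M) := fext (fun _ => \1%VF).

Lemma mu_hom M : is_hom (mu M). Proof. exact: fext_hom. Qed.

Lemma mu_pin M s v : mu M (pin hn s v) = pact M s v.
Proof.
rewrite fextE (bigD1 s) //= coord_pin eqxx id_lfunE big1 ?addr0 // => t ne.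
by rewrite coord_pin (negPf ne) !linear0.
Qed.

Lemma limg_mu M : limg (mu M) = fullv.
Proof.
apply/vspaceP => v; rewrite memvf; apply/memv_imgP.
exists (\sum_i pin hn (pe i) v); first exact: memvf.
rewrite lfun_sum -{1}(mE_sum v); apply: eq_bigr => i _.
by rewrite mu_pin.
Qed.

Definition syz M : fdmod (Lambda K hn) := submod (kernel_submodule (@mu_hom M)).
Definition syz_incl M : 'Hom(syz M, free M) := incl (kernel_submodule (@mu_hom M)).

Lemma mu_syz M (x : syz M) : mu M (syz_incl M x) = 0.
Proof. by apply/eqP; rewrite -memv_ker inclE subvsP. Qed.

Lemma syz_inclP M (x : free M) : mu M x = 0 -> exists y, syz_incl M y = x.
Proof.
move=> x0; have : x \in limg (syz_incl M) by rewrite limg_incl memv_ker x0.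
by case/memv_imgP => y _ ->; exists y.
Qed.

Lemma syz_incl_hom M : is_hom (syz_incl M). Proof. exact: incl_hom. Qed.

Definition syzn M k := iter k syz M.

Lemma limg_comp_mu M N (f : 'Hom(M, N)) : limg (f \o mu M)%VF = limg f.
Proof. by rewrite limg_comp limg_mu. Qed.

Definition resolution M : projective_resolution M.
Proof.
exists (fun k => free (syzn M k))
  (fun k => (syz_incl (syzn M k) \o mu (syzn M k.+1))%VF) (mu M).
- by move=> k; apply: free_projective.
- by move=> k; apply: comp_hom; [exact: syz_incl_hom | exact: mu_hom].
- exact: mu_hom.
- exact: limg_mu.
- by rewrite limg_comp_mu limg_incl.
- move=> k; rewrite limg_comp_mu limg_incl; apply/vspaceP => x.
  rewrite !memv_ker comp_lfunE; apply/eqP/eqP => [->|]; first by rewrite linear0.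
  by rewrite inclE => e; apply: subvs_inj; rewrite e.
(* Kept transparent: the terms and differentials of the resolution must compute in [Ext_extends]. *)
Defined.

(** Dimension shifting: [f] composed with the cover of its source is a cocycle. Once it is a
    coboundary, surjectivity of the cover cancels [mu] from both sides. *)
Lemma Ext_extends M N k (f : 'Hom(syzn M k.+1, N)) :
  Ext_eq0 k.+1 M N -> is_hom f ->
  exists2 g : 'Hom(free (syzn M k), N), is_hom g &
    forall x, f x = g (syz_incl _ x).
Proof.
move=> /(_ (resolution M) (f \o mu (syzn M k.+1))%VF) Ek hf.
have [|g hg e] := Ek.
  split; first exact: comp_hom hf (@mu_hom _).
  apply/lfunP => x; rewrite !comp_lfunE zero_lfunE.
  by rewrite -[X in f X]/(mu _ (syz_incl _ _)) mu_syz linear0.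
exists g => // x.
have : x \in limg (mu (syzn M k.+1)) by rewrite limg_mu memvf.
case/memv_imgP => y _ ->.
by move/lfunP/(_ y): e; rewrite !comp_lfunE.
Qed.

End Resolution.

(** * Homology classes and syzygies *)

Section Homology.
Variables (K : fieldType) (n : nat) (hn : (2 <= n)%N).
Implicit Types M N : fdmod (Lambda K hn).

(** A nonzero homology class at [i], given as a cycle [u] and a functional that is zero on
    boundaries and detects [u]. This form needs no quotient spaces, and both data can be transported
    to a syzygy. *)
Definition homB i M : Prop := exists (u : M) (phi : 'Hom(M, K^o)),
  [/\ mE M i u = u /\ forall x, phi (mE M i x) = phi x,
      forall j, mB M j u = 0, forall j x, phi (mB M j x) = 0 & phi u <> 0].

Definition homA i M : Prop := exists (u : M) (phi : 'Hom(M, K^o)),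
  [/\ mE M i u = u /\ forall x, phi (mE M i x) = phi x,
      forall j, mA M j u = 0, forall j x, phi (mA M j x) = 0 & phi u <> 0].

(* [u] is a class for A that moreover survives in the top of [M]: [phi] kills
   the radical. *)
Definition homAtop i M : Prop := exists (u : M) (phi : 'Hom(M, K^o)),
  [/\ mE M i u = u /\ forall x, phi (mE M i x) = phi x,
      forall j, mA M j u = 0, forall j x, phi (mA M j x) = 0,
      forall j x, phi (mB M j x) = 0 & phi u <> 0].

Section Syzygy.
Variable M : fdmod (Lambda K hn).
Implicit Types (x : syz M) (phi : 'Hom(M, K^o)).

Definition scoord x s : M := fcoord (syz_incl M x) s.

Lemma scoordE i x s :
  scoord (mE _ i x) s = if i == ptarget s then scoord x s else 0.
Proof. by rewrite /scoord hom_mE ?coordE //; apply: syz_incl_hom. Qed.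
Lemma scoordA j x s :
  scoord (mA _ j x) s = if s == pa j then scoord x (pe (lower j)) else 0.
Proof. by rewrite /scoord hom_mA ?coordA //; apply: syz_incl_hom. Qed.
Lemma scoordB j x s :
  scoord (mB _ j x) s = if s == pb j then scoord x (pe (upper j))
    else if s == pc j then scoord x (pa j) else 0.
Proof. by rewrite /scoord hom_mB ?coordB //; apply: syz_incl_hom. Qed.

Definition scoordf s : 'Hom(syz M, M) := (coordf hn M s \o syz_incl M)%VF.
Lemma scoordfE s x : scoordf s x = scoord x s.
Proof. by rewrite comp_lfunE coordfE. Qed.

(** The equation that defines the syzygy, read through [phi]. Each use keeps the few terms that
    [phi] does not kill. *)
Lemma syz_relation phi x : \sum_s phi (pact M s (scoord x s)) = 0.
Proof.
transitivity (phi (mu M (syz_incl M x))); last by rewrite mu_syz linear0.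
by rewrite fextE lfun_sum; apply: eq_bigr => s _; rewrite id_lfunE.
Qed.

Lemma syz_inj x y : (forall s, scoord x s = scoord y s) -> x = y.
Proof.
move=> xy; apply: subvs_inj; rewrite -!inclE; apply: free_ext; exact: xy.
Qed.

Lemma syz_pin s v : pact M s v = 0 -> {x | forall t, scoord x t = if t == s then v else 0}.
Proof.
move=> sv; apply: cid; have [|x xE] := @syz_inclP _ _ _ M (pin hn s v).
  by rewrite mu_pin.
by exists x => t; rewrite /scoord xE coord_pin.
Qed.

(** A functional that lives at [i] and kills the radical leaves only the term of [pe i] in
    [syz_relation]. *)
Lemma scoord_top i phi x :
  (forall y, phi (mE M i y) = phi y) -> (forall j y, phi (mA M j y) = 0) ->
  (forall j y, phi (mB M j y) = 0) -> phi (scoord x (pe i)) = 0.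
Proof.
move=> phiE phiA phiB; have := syz_relation phi x.
rewrite (bigD1 (pe i)) // phiE big1 => [<-|[[k|k]|[k|k]] ne].
- exact/esym/addr0.
- rewrite -phiE mEE; case: eqP => [ik|_]; last exact: linear0.
  by rewrite ik eqxx in ne.
- exact: phiA.
- exact: phiB.
- by rewrite comp_lfunE phiB.
Qed.

End Syzygy.

(** The new cycle is [alpha'_j] tensor [u], a syzygy because B kills [u]. Its functional kills the
    images of both A and B, so one pair serves as the B-class that descends further and as the top
    A-class that can turn upwards. *)
Lemma homB_syz j M :
  homB (upper j) M -> homB (lower j) (syz M) /\ homAtop (lower j) (syz M).
Proof.
case=> u [phi [[Eu phiE] Bu phiB phiu]].
have [x xE] := @syz_pin M (pb j) u (Bu j).
(* The coordinate at [pb j] alone detects the cycle; the term at [pc j] is added so that [psi]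
   vanishes on the image of B. *)
pose psi := (phi \o (scoordf M (pb j) + (mA M j \o scoordf M (pc j))))%VF.
have psiE y : psi y = phi (scoord y (pb j)) + phi (mA M j (scoord y (pc j))).
  by rewrite comp_lfunE add_lfunE comp_lfunE !scoordfE linearD.
have Ex : mE _ (lower j) x = x.
  apply: syz_inj => t; rewrite scoordE xE; case: (eqVneq t (pb j)) => [->|].
    by rewrite eqxx.
  by rewrite if_same.
have psi_E y : psi (mE _ (lower j) y) = psi y.
  by rewrite !psiE !scoordE !eqxx.
have Ax k : mA _ k x = 0.
  by apply: syz_inj => t; rewrite scoordA xE if_same -scoordfE linear0.
have Bx k : mB _ k x = 0.
  by apply: syz_inj => t; rewrite scoordB !xE !if_same -scoordfE linear0.
have psiA k y : psi (mA _ k y) = 0.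
  by rewrite psiE !scoordA /= !linear0 addr0.
have psiB k y : psi (mB _ k y) = 0.
  rewrite psiE !scoordB -![pb j == pb k]/(j == k) -![pc j == pc k]/(j == k).
  rewrite -[pc j == pb k]/false; case: (eqVneq j k) => [<-|_]; last first.
    by rewrite !linear0 addr0.
  (* The two summands of [psi (B_j y)] are exactly the terms of the relation at [pe (upper j)] and
     [pa j], the only ones that [phi] does not kill. *)
  have := syz_relation phi y; rewrite (bigD1 (pe (upper j))) // phiE.
  rewrite (bigD1 (pa j)) // big1 => [|[[i|i]|[i|i]] ne].
  - by move=> <-; congr (_ + _); exact/esym/addr0.
  - rewrite -phiE mEE; case: eqP => [ik|_]; last exact: linear0.
    by rewrite ik eqxx in ne.
  - rewrite -phiE mEA (inj_eq (@upper_inj _)).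
    case: eqP => [ik|_]; last exact: linear0.
    by rewrite ik eqxx andbF in ne.
  - exact: phiB.
  - by rewrite comp_lfunE phiB.
have psix : psi x <> 0 by rewrite psiE !xE eqxx /= !linear0 addr0.
by split; exists x, psi.
Qed.

(** The new cycle is [alpha_j] tensor [u]. Its functional kills the image of A by [scoord_top],
    which is where vanishing of [phi] on the whole radical enters. *)
Lemma homAtop_syz j M : homAtop (lower j) M -> homAtop (upper j) (syz M).
Proof.
case=> u [phi [[Eu phiE] Au phiA phiB phiu]].
have [x xE] := @syz_pin M (pa j) u (Au j).
exists x, (phi \o scoordf M (pa j))%VF.
have psiE y : (phi \o scoordf M (pa j))%VF y = phi (scoord y (pa j)).
  by rewrite comp_lfunE scoordfE.
split=> [|k|k y|k y|]; rewrite ?psiE.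
- split=> [|y]; last by rewrite !psiE scoordE eqxx.
  apply: syz_inj => t; rewrite scoordE xE; case: (eqVneq t (pa j)) => [->|].
    by rewrite eqxx.
  by rewrite if_same.
- by apply: syz_inj => t; rewrite scoordA xE if_same -scoordfE linear0.
- rewrite scoordA -[pa j == pa k]/(j == k); case: (eqVneq j k) => [<-|_].
    exact: scoord_top.
  exact: linear0.
- by rewrite scoordB /= linear0.
- by rewrite xE eqxx.
Qed.

(* A homomorphism from the syzygy that does not extend to the free cover is a
   nonzero class in Ext^1. *)
Lemma homAtop_obstruction j M N : homAtop (lower j) M -> homA (upper j) N ->
  exists2 f : 'Hom(syz M, N), is_hom f &
  forall g : 'Hom(free_mod hn M, N), is_hom g ->
    ~ (forall x, f x = g (syz_incl M x)).
Proof.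
case=> u [chi [[Eu chiE] Au chiA chiB chiu]].
case=> v [lam [[Ev lamE] Av lamA lamv]].
(* The first summand sends the cycle [alpha_j] tensor [u] to a nonzero multiple of [v]. The second
   is forced by compatibility with B, since [alpha'_j] carries the coordinate at [pa j] to
   [pc j]. *)
pose f_fun (x : syz M) : N :=
  chi (scoord x (pa j)) *: v + chi (scoord x (pc j)) *: mB N j v.
have f_linear : linear f_fun.
  have cl s : linear (fun x => chi (scoord x s)).
    by move=> k x y; rewrite -!scoordfE !linearP.
  move=> k x y; rewrite /f_fun !cl !scalerDl scalerDr !scalerA.
  by rewrite addrACA.
pose f := lfun_of f_linear.
have fE x : f x = chi (scoord x (pa j)) *: v + chi (scoord x (pc j)) *: mB N j v.
  exact: lfun_ofE.
exists f => [|g hg fg].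
  apply: is_homP => [i x|k x|k x]; rewrite !fE linearD !linearZ /=.
  - have -> : mE N i v = if i == upper j then v else 0.
      by rewrite -{1}Ev mEE; case: eqP => [->|].
    rewrite !scoordE mEB /=; case: (i == upper j); case: (i == lower j) => /=;
      by rewrite ?linear0 ?scale0r ?scaler0.
  - rewrite Av mAB !scaler0 !addr0 !scoordA /=.
    rewrite -[pa j == pa k]/(j == k).
    case: (eqVneq j k) => [<-|_]; rewrite ?linear0 ?scale0r ?addr0 //.
    by rewrite scoord_top // scale0r.
  - rewrite mBB scaler0 addr0 !scoordB /= linear0 scale0r add0r.
    rewrite -[pc j == pc k]/(j == k) -{2}Ev mBE (inj_eq (@upper_inj _)) eq_sym.
    by case: (eqVneq k j) => [->|_]; rewrite ?linear0 ?scale0r ?scaler0.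
have [x xE] := @syz_pin M (pa j) u (Au j).
have := fg x; rewrite fE !xE eqxx /= linear0 scale0r addr0.
(* In the cover, though not in the syzygy, the cycle is an A-boundary. An extension [g] would
   therefore send it into the image of A, which [lam] kills, while [f] sends it to [chi u *: v]. *)
have -> : syz_incl M x = mA (free_mod hn M) j (pin hn (pe (lower j)) u).
  rewrite mA_pin; apply: free_ext => t; rewrite coord_pin; exact: xE.
rewrite (hom_mA _ _ hg) => /(congr1 lam); rewrite linearZ lamA => /eqP.
by rewrite mulf_eq0 => /orP[] /eqP.
Qed.

Lemma syzn_syzn M a b : syzn (syzn M a) b = syzn M (b + a).
Proof. by rewrite /syzn iterD. Qed.

(** The B-class is used until the last step, which takes the top A-class instead. As that class can
    only move up, starting it at the lowest vertex makes every target vertex reachable. *)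
Lemma homB_descend d (hd : (d < n.-1)%N) M : homB (upper (Ordinal hd)) M ->
  exists m, homAtop (Ordinal (ltnW hn)) (syzn M m).
Proof.
elim: d => [|d IH] in hd M * => /homB_syz[HB HA].
  by exists 1%N; move: HA; congr homAtop; apply: val_inj.
have hd' := ltnW hd.
have [|m Hm] := IH hd' (syz M); first by move: HB; congr homB; apply: val_inj.
by exists m.+1; rewrite /syzn iterSr.
Qed.

Lemma homAtop_ascend d (hd : (d < n)%N) M : homAtop (Ordinal (ltnW hn)) M ->
  exists m, homAtop (Ordinal hd) (syzn M m).
Proof.
move=> M0; elim: d => [|d IH] in hd *.
  by exists 0%N; move: M0; congr homAtop; apply: val_inj.
have [m Hm] := IH (ltnW hd).
have hd' : (d < n.-1)%N by rewrite ltn_predRL.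
have := @homAtop_syz (Ordinal hd') (syzn M m).
have -> : lower (Ordinal hd') = Ordinal (ltnW hd) by apply: val_inj.
have -> : upper (Ordinal hd') = Ordinal hd by apply: val_inj.
by move=> /(_ Hm) ?; exists m.+1.
Qed.

Lemma Ext_neq0 j j' M N : homB (upper j) M -> homA (upper j') N ->
  exists2 m : nat, (1 <= m)%N & ~ Ext_eq0 m M N.
Proof.
case: j => d hd /homB_descend[m1 /(homAtop_ascend (lower_subproof j'))[m2]].
rewrite syzn_syzn -/(lower j') => Htop HN.
have [f hf nf] := homAtop_obstruction Htop HN.
(* The ascent stops at [lower j']; the last move up, to [upper j'], is the obstruction itself and
   accounts for the successor. *)
exists (m2 + m1).+1 => // E0.
by have [g hg fg] := Ext_extends E0 hf; apply: nf hg fg.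
Qed.

End Homology.

(** * Filtrations and small modules *)

Lemma separating_functional (K : fieldType) (V : vectType K) (W : {vspace V}) v :
  v \notin W -> exists2 phi : 'Hom(V, K^o),
    forall w, w \in W -> phi w = 0 & phi v = 1.
Proof.
move=> vW; pose X := [tuple of v :: vbasis W].
have Xfree : free X.
  by rewrite free_cons (span_basis (vbasisP W)) vW (basis_free (vbasisP W)).
have cl : linear (fun x => coord X ord0 x : K^o).
  by move=> k x y; rewrite linearP.
exists (lfun_of cl) => [w wW|]; rewrite lfun_ofE; last first.
  have := coord_free ord0 ord0 Xfree; rewrite eqxx; exact.
rewrite (coord_vbasis wW) linear_sum big1 // => i _; rewrite linearZ /=.
have := coord_free (lift ord0 i) ord0 Xfree.
by rewrite /= => ->; exact: mulr0.
Qed.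

Section Chains.
Variables (K : fieldType) (A : algType K) (C : fdmod A -> Prop) (M : fdmod A).
Implicit Types U W : {vspace M}.

(** An unindexed form of filtrations that can be lengthened at either end: [Delta_step] adds a layer
    at the bottom, [nabla_step] one at the top. *)
Inductive chain : {vspace M} -> {vspace M} -> Prop :=
| chain_refl U of is_submodule U : chain U U
| chain_step U U' W X of is_submodule U & C X & subquotient_iso U U' X
    & chain U' W : chain U W.

Lemma chain_trans U U' W : chain U U' -> chain U' W -> chain U W.
Proof.
elim=> // {}U V {}U' X sU CX UV _ IH /IH.
exact: chain_step sU CX UV.
Qed.

Lemma chain_filtered : chain 0%VS fullv -> filtered_by C M.
Proof.
suff H U W : chain U W -> exists t (F : nat -> {vspace M}),
    [/\ F 0%N = U, F t = W, forall k, (k <= t)%N -> is_submodule (F k)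
      & forall k, (k < t)%N ->
          exists2 X, C X & subquotient_iso (F k) (F k.+1) X].
  by move/H => [t [F HF]]; exists t, F.
elim=> {U W} [U sU|U U' W X sU CX UU' _ [t [F [F0 Ft sF qF]]]].
  by exists 0%N, (fun=> U); split.
exists t.+1, (fun k => if k is k'.+1 then F k' else U); split=> // [[|k]|[|k]] //.
- exact: sF.
- by move=> _; exists X; rewrite ?F0.
- exact: qF.
Qed.

End Chains.

(** * Simple modules and uniserial modules of length two *)

Section SmallModules.
Variables (K : fieldType) (n : nat) (hn : (2 <= n)%N).

Section OneDimensional.
Variable i : 'I_n.

Definition oE (k : 'I_n) : 'End(K^o) := if k == i then \1%VF else 0.
Definition oZ (j : 'I_n.-1) : 'End(K^o) := 0.

Lemma oEE k l : (oE k \o oE l)%VF = if k == l then oE k else 0.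
Proof.
rewrite /oE; case: (eqVneq k l) => [->|ne].
  by case: eqP => _; rewrite ?comp_lfun1l ?comp_lfun0l.
case: (eqVneq k i) => [ki|_]; last by rewrite comp_lfun0l.
by rewrite -ki eq_sym (negPf ne) comp_lfun0r.
Qed.
Lemma oE1 : \sum_k oE k = \1%VF.
Proof.
rewrite (bigD1 i) //= /oE eqxx big1 ?addr0 // => k.
by case: eqP.
Qed.

Lemma comp_oZ (f : 'End(K^o)) j : (f \o oZ j)%VF = oZ j.
Proof. exact: comp_lfun0r. Qed.
Lemma oZ_comp (f : 'End(K^o)) j : (oZ j \o f)%VF = oZ j.
Proof. exact: comp_lfun0l. Qed.

Definition one_rep : lrep n K^o :=
  LRep oEE oE1 (fun j => comp_oZ _ j) (fun j => oZ_comp _ j)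
    (fun j => comp_oZ _ j) (fun j => oZ_comp _ j)
    (fun i _ => comp_oZ _ i) (fun i _ => comp_oZ _ i) (fun i _ => comp_oZ _ i).

Definition one_mod : fdmod (Lambda K hn) := rep_mod hn one_rep.

Lemma one_mod_L : is_L i one_mod.
Proof.
split.
  split=> [|U _]; first by rewrite dimvf /dim /=.
  have [|U0] := eqVneq U 0%VS; first by left.
  right; apply/eqP; rewrite eqEdim subvf dimvf /dim /= lt0n dimv_eq0 //.
rewrite rep_mod_idem /= /oE eqxx => /lfunP/(_ 1).
by rewrite id_lfunE zero_lfunE => /eqP; rewrite oner_eq0.
Qed.
End OneDimensional.

Section TwoDimensional.
Variables (s t : 'I_n) (fa fb : 'I_n.-1 -> bool).
Hypothesis st : s != t.
Hypothesis faP : forall j, fa j -> lower j = s /\ upper j = t.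
Hypothesis fbP : forall j, fb j -> upper j = s /\ lower j = t.
Local Notation V := (K^o * K^o)%type.

(** The first coordinate is the top, at [s], the second the socle, at [t]; [fa] and [fb] mark the
    arrows that carry one to the other. Standard and costandard modules are both instances. *)
Definition wE_fun (k : 'I_n) (x : V) : V :=
  (if k == s then x.1 else 0, if k == t then x.2 else 0).
Definition wN_fun (b : bool) (x : V) : V := (0, if b then x.1 else 0).
Lemma wE_linear k : linear (wE_fun k).
Proof.
move=> a x y; rewrite /wE_fun; congr pair => /=;
  by case: eqP; rewrite ?scaler0 ?addr0.
Qed.
Lemma wN_linear b : linear (wN_fun b).
Proof.
by move=> a x y; rewrite /wN_fun; congr pair => /=;
  rewrite ?scaler0 ?addr0 //; case: b; rewrite ?scaler0 ?addr0.
Qed.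
Definition wE k := lfun_of (@wE_linear k).
Definition wN b := lfun_of (@wN_linear b).

Lemma wEE k l : (wE k \o wE l)%VF = if k == l then wE k else 0.
Proof.
apply/lfunP => x; rewrite comp_lfunE (fun_if (fun f : 'End(_) => f x)) zero_lfunE.
rewrite !lfun_ofE /wE_fun /=; case: (eqVneq k l) => [->|ne].
  by case: (l == s); case: (l == t).
by congr pair; case: eqP => // <-; rewrite eq_sym (negPf ne).
Qed.
Lemma wE1 : \sum_k wE k = \1%VF.
Proof.
apply/lfunP => x; rewrite sum_lfunE id_lfunE (bigD1 s) // (bigD1 t) ?(eq_sym t) //=.
rewrite !lfun_ofE /wE_fun !eqxx (negPf st) (eq_sym t) (negPf st) big1.
  by case: x => a b; rewrite addr0; congr pair; rewrite /= ?addr0 ?add0r.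
by move=> k /andP[/negPf ks /negPf kt]; rewrite lfun_ofE /wE_fun ks kt.
Qed.
Lemma wNE (b : bool) k : (b -> k = t) -> (wE k \o wN b)%VF = wN b.
Proof.
move=> bt; apply/lfunP => x; rewrite comp_lfunE !lfun_ofE /wE_fun /wN_fun /=.
by congr pair; rewrite ?if_same //; case: b bt => [->|]; rewrite ?eqxx ?if_same.
Qed.
Lemma wEN (b : bool) k : (b -> k = s) -> (wN b \o wE k)%VF = wN b.
Proof.
move=> bs; apply/lfunP => x; rewrite comp_lfunE !lfun_ofE /wE_fun /wN_fun /=.
by congr pair; case: b bs => [->|] //; rewrite ?eqxx.
Qed.
Lemma wNN b c : (wN b \o wN c)%VF = 0.
Proof.
apply/lfunP => x; rewrite comp_lfunE zero_lfunE !lfun_ofE /wN_fun /=.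
by rewrite if_same.
Qed.

Definition two_rep : lrep n V :=
  @LRep _ _ _ wE (fun j => wN (fa j)) (fun j => wN (fb j)) wEE wE1
  (fun j => wNE (fun h => proj2 (faP h))) (fun j => wEN (fun h => proj1 (faP h)))
  (fun j => wNE (fun h => proj2 (fbP h))) (fun j => wEN (fun h => proj1 (fbP h)))
  (fun _ _ => wNN _ _) (fun _ _ => wNN _ _) (fun _ _ => wNN _ _).

Definition two_mod : fdmod (Lambda K hn) := rep_mod hn two_rep.

Lemma two_mE k x : mE two_mod k x = wE_fun k x.
Proof. by rewrite mE_rep lfun_ofE. Qed.
Lemma two_mA j x : mA two_mod j x = wN_fun (fa j) x.
Proof. by rewrite mA_rep lfun_ofE. Qed.
Lemma two_mB j x : mB two_mod j x = wN_fun (fb j) x.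
Proof. by rewrite mB_rep lfun_ofE. Qed.

Definition winj_fun (x : one_mod t) : two_mod := (0, x).
Definition wprj_fun (x : two_mod) : one_mod s := x.1.
Lemma winj_linear : linear winj_fun.
Proof. by move=> a x y; rewrite /winj_fun; congr pair; rewrite /= scaler0 addr0. Qed.
Lemma wprj_linear : linear wprj_fun.
Proof. by []. Qed.

Lemma two_uniserial j : fa j || fb j -> uniserial2 (is_L s) (is_L t) two_mod.
Proof.
move=> faj.
pose f := lfun_of winj_linear; pose g := lfun_of wprj_linear.
have fE x : f x = (0, x) by exact: lfun_ofE.
have gE x : g x = x.1 by exact: lfun_ofE.
have imf x : (x \in limg f) = (x.1 == 0).
  apply/memv_imgP/eqP => [[y _ ->]|x0]; first by rewrite fE.
  by exists x.2; rewrite ?memvf // fE -x0; case: (x).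
exists (one_mod t), (one_mod s), f, g; split.
- exact: one_mod_L.
- exact: one_mod_L.
- split.
  + apply: is_homP => [k x|k x|k x]; rewrite ?fE.
    * rewrite two_mE mE_rep /= /oE /wE_fun /=; congr pair; first by rewrite if_same.
      by case: eqP; rewrite ?id_lfunE ?zero_lfunE.
    * by rewrite two_mA mA_rep /wN_fun /= if_same zero_lfunE.
    * by rewrite two_mB mB_rep /wN_fun /= if_same zero_lfunE.
  + apply: is_homP => [k x|k x|k x]; rewrite ?gE.
    * rewrite two_mE mE_rep /= /oE.
      by case: eqP; rewrite ?id_lfunE ?zero_lfunE.
    * by rewrite two_mA mA_rep zero_lfunE.
    * by rewrite two_mB mB_rep zero_lfunE.
  + by apply/eqP/lker0P => x y; rewrite !fE => -[].
  + by apply/vspaceP => x; rewrite imf memv_ker gE.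
  + apply/vspaceP => x; rewrite memvf; apply/memv_imgP.
    by exists (x, 0); rewrite ?memvf ?gE.
- move=> U sU.
  (* A vector with nonzero top coordinate generates the module: the idempotent at [s] isolates that
     coordinate and the arrow moves it to the socle. Without such a vector, [U] lies in the image of
     [f], which is at most a line. *)
  have [[x xU x1]|U1] := pselect (exists2 x, x \in U & x.1 != 0).
    apply: Or33; apply/vspaceP => y; rewrite memvf.
    have Ux : ((x.1, 0) : two_mod) \in U.
      by have := submodule_mE s sU xU; rewrite two_mE /wE_fun eqxx (negPf st).
    have Nx : ((0, x.1) : two_mod) \in U.
      case/orP: faj => fj.
        by have := submodule_mA j sU xU; rewrite two_mA fj.
      by have := submodule_mB j sU xU; rewrite two_mB fj.
    have -> : y = (y.1 / x.1) *: ((x.1, 0) : two_mod) + (y.2 / x.1) *: (0, x.1).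
      by case: y => a b; congr pair; rewrite /= ?scaler0 ?addr0 ?add0r;
        rewrite -[RHS]/(_ * _) divfK.
    by rewrite memvD // memvZ.
  have Uf : (U <= limg f)%VS.
    apply/subvP => x xU; rewrite imf; apply/negPn/negP => x0.
    by apply: U1; exists x.
  have [U0|U0] := eqVneq U 0%VS; first exact: Or31.
  apply: Or32; apply/eqP; rewrite eqEdim Uf /=.
  have : (\dim (limg f) <= 1)%N.
    have := leq_addl (\dim (fullv :&: lker f)) (\dim (limg f)).
    by rewrite limg_ker_dim dimvf.
  move/leq_trans; apply.
  by rewrite lt0n dimv_eq0.
Qed.

End TwoDimensional.
End SmallModules.

(** * Exactness and filtrations *)

Section Filtrations.
Variables (K : fieldType) (n : nat) (hn : (2 <= n)%N).
Local Notation modL := (fdmod (Lambda K hn)).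

Lemma upper_neq_lower (j : 'I_n.-1) : upper j != lower j.
Proof. by apply/eqP => /(congr1 val) /= /eqP; rewrite -{2}[val j]addn0 -addn1 eqn_add2l. Qed.

Lemma lower_neq_upper (j : 'I_n.-1) : lower j != upper j.
Proof. by rewrite eq_sym upper_neq_lower. Qed.

Lemma vertexP (i : 'I_n) : i = 0%N :> nat \/ exists j, i = upper j.
Proof.
case: i => [[|i] hi]; [by left | right].
have hj : (i < n.-1)%N by rewrite ltn_predRL.
by exists (Ordinal hj); apply: val_inj.
Qed.

Definition Delta_mod (j : 'I_n.-1) : modL :=
  @two_mod K n hn (upper j) (lower j) xpred0 (pred1 j) (upper_neq_lower j)
    (fun k (h : false) => match notF h with end)
    (fun k h => match elimT eqP h in _ = l
                return upper k = upper l /\ lower k = lower l with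
                | erefl => conj erefl erefl end).

Definition nabla_mod (j : 'I_n.-1) : modL :=
  @two_mod K n hn (lower j) (upper j) (pred1 j) xpred0 (lower_neq_upper j)
    (fun k h => match elimT eqP h in _ = l
                return lower k = lower l /\ upper k = upper l with
                | erefl => conj erefl erefl end)
    (fun k (h : false) => match notF h with end).

Lemma Delta_modP j : is_Delta (upper j) (Delta_mod j).
Proof.
right; exists (lower j) => //; apply: (@two_uniserial K n hn _ _ _ _ _ _ _ j).
by rewrite /= eqxx.
Qed.

Lemma nabla_modP j : is_nabla (upper j) (nabla_mod j).
Proof.
right; exists (lower j) => //; apply: (@two_uniserial K n hn _ _ _ _ _ _ _ j).
by rewrite /= eqxx.
Qed.

Section Module.
Variable M : modL.
Implicit Types U W : {vspace M}.

Lemma rel_homP U (X : modL) (p : 'Hom(M, X)) : is_submodule U ->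
  (forall k v, v \in U -> p (mE M k v) = mE X k (p v)) ->
  (forall k v, v \in U -> p (mA M k v) = mA X k (p v)) ->
  (forall k v, v \in U -> p (mB M k v) = mB X k (p v)) ->
  forall a v, v \in U -> p (act M a v) = act X a (p v).
Proof.
rewrite mE.unlock mA.unlock mB.unlock => sU pE pA pB.
apply: Lambda_ind => [k x y hx hy|i|j x hx|j x hx] v vU.
- rewrite (linearP (act M)) (linearP (act X)) !add_lfunE !scale_lfunE.
  by rewrite linearD linearZ /= hx ?hy.
- exact: pE.
- by rewrite -!act_comp -hx //; apply: pA; apply: submoduleE.
- by rewrite -!act_comp -hx //; apply: pB; apply: submoduleE.
Qed.

Lemma subquotient_ker U (X : modL) (p : 'Hom(M, X)) : is_submodule U ->
  (forall a v, v \in U -> p (act M a v) = act X a (p v)) ->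
  (p @: U)%VS = fullv ->
  is_submodule (U :&: lker p)%VS /\ subquotient_iso (U :&: lker p)%VS U X.
Proof.
move=> sU hp pU; split; last by split; [exact: capvSl | exists p].
move=> a; apply/subvP => _ /memv_imgP[v vU ->]; move: vU.
rewrite !memv_cap !memv_ker => /andP[vU /eqP pv].
by rewrite submoduleE // hp // pv linear0 eqxx.
Qed.

(** The preimage must lie in [U], so this is exactness of the submodule itself. The lowest vertex is
    left out because the costandard module there is simple. *)
Definition Aexact U := forall j u, u \in U -> mE M (upper j) u = u ->
  (forall k, mA M k u = 0) -> exists2 y, y \in U & u = mA M j y.

Definition imB : {vspace M} := (\sum_k limg (mB M k))%VS.

(* Exactness of the quotient [M / U], phrased inside [M]. *)
Definition Bexact U := forall j u, mE M (upper j) u = u ->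
  mB M j u \in U -> u \in (U + imB)%VS.

Lemma mB_imB k v : mB M k v \in imB.
Proof. by apply: (subvP (sumv_sup k _ _)) (memv_img _ (memvf v)). Qed.

(** A cycle outside the sum of the images of A is separated from it by a functional and gives a
    class. Otherwise projection to [upper j] retains only the boundary along [alpha_j]. *)
Lemma Aexact_full : (forall j, ~ homA (upper j) M) -> Aexact fullv.
Proof.
move=> nA j u _ Eu Au.
have [/memv_sumP[y yA ue]|nu] := boolP (u \in (\sum_k limg (mA M k))%VS).
  have /memv_imgP[z _ ze] := yA j isT.
  exists z; rewrite ?memvf // -ze -Eu ue lfun_sum (bigD1 j) //= big1 ?addr0.
    by rewrite ze mEA eqxx.
  move=> k kj; have /memv_imgP[w _ ->] := yA k isT.
  by rewrite mEA (inj_eq (@upper_inj _)) eq_sym (negPf kj).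
have [phi phi0 phi1] := separating_functional nu.
case: (nA j); exists u, (phi \o mE M (upper j))%VF.
split=> [|//|k x|]; rewrite ?comp_lfunE ?Eu ?phi1.
- by split=> // x; rewrite !comp_lfunE mEE eqxx.
- rewrite mEA; case: ifP => _; rewrite ?linear0 // phi0 //.
  by apply: (subvP (sumv_sup k _ _)) (memv_img _ (memvf x)).
- by apply/eqP; rewrite oner_eq0.
Qed.

Lemma Bexact0 : (forall j, ~ homB (upper j) M) -> Bexact 0%VS.
Proof.
move=> nB j u Eu; rewrite memv0 add0v => /eqP Bu.
apply/negPn/negP => nu; have [phi phi0 phi1] := separating_functional nu.
case: (nB j); exists u, (phi \o mE M (upper j))%VF.
split=> [|k|k x|]; rewrite ?comp_lfunE ?Eu ?phi1.
- by split=> // x; rewrite !comp_lfunE mEE eqxx.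
- rewrite -Eu mBE (inj_eq (@upper_inj _)).
  by case: eqP => // <-.
- by rewrite mEB; case: ifP => _; rewrite ?linear0 // phi0 // mB_imB.
- by apply/eqP; rewrite oner_eq0.
Qed.

Lemma max_vertex (P : 'I_n -> Prop) : (exists i, P i) ->
  exists2 i, P i & forall k : 'I_n, (i < k)%N -> ~ P k.
Proof.
case=> i0 /asboolP Pi0.
case: (@arg_maxnP _ i0 (fun i => `[< P i >]) (fun i => i) Pi0) => i /asboolP Pi ge.
exists i => // k ik /asboolP /ge; rewrite /= leqNgt => /negP; exact.
Qed.

(* A costandard quotient of [U] at the highest vertex that [U] meets. *)
Lemma nabla_step U : is_submodule U -> Aexact U -> U != 0%VS ->
  exists U', [/\ is_submodule U', Aexact U', (\dim U' < \dim U)%N &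
    exists2 X, exists i, is_nabla i X & subquotient_iso U' U X].
Proof.
move=> sU eU U0.
have [i [v vU v0] imax] :
    exists2 i, (exists2 v, v \in U & mE M i v != 0) &
      forall k : 'I_n, (i < k)%N -> ~ exists2 v, v \in U & mE M k v != 0.
  apply: max_vertex; apply/not_existsP => nE.
  case/negP: U0; rewrite -subv0; apply/subvP => v vU; rewrite memv0 -(mE_sum v).
  rewrite big1 // => i _; apply/eqP/negPn/negP => Ev.
  by apply: (nE i); exists v.
have Emax (k : 'I_n) x : x \in U -> (i < k)%N -> mE M k x = 0.
  move=> xU ik; apply/eqP/negPn/negP => Ex; apply: (imax k ik).
  by exists x.
have {}vU : mE M i v \in U by apply: submodule_mE.
have Eu : mE M i (mE M i v) = mE M i v by rewrite mEE eqxx.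
move: (mE M i v) v0 vU Eu => {v} v v0 vU Ev.
have [phi0 _ phi0v] : exists2 phi : 'Hom(M, K^o),
    forall w, w \in 0%VS -> phi w = 0 & phi v = 1.
  by apply: separating_functional; rewrite memv0.
pose phi := (phi0 \o mE M i)%VF.
have phiE k x : phi (mE M k x) = if i == k then phi x else 0.
  by rewrite !comp_lfunE mEE; case: ifP => _; rewrite ?linear0.
have phiv : phi v = 1 by rewrite comp_lfunE Ev.
(* A B-boundary at [i] would come from the next vertex, where [U] is zero. *)
have phiB k x : x \in U -> phi (mB M k x) = 0.
  move=> xU; rewrite comp_lfunE mEB; case: eqP => [ik|_]; last exact: linear0.
  have <- : mB M k (mE M (upper k) x) = mB M k x by rewrite mBE eqxx.
  by rewrite Emax // ?ik ?ltnSn // !linear0.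
have AU k x : x \in U -> lower k = i -> mA M k x = 0.
  move=> xU ki; have <- : mE M (upper k) (mA M k x) = mA M k x by rewrite mEA eqxx.
  by rewrite Emax ?submodule_mA // -ki /=.
have dimlt (X : modL) (p : 'Hom(M, X)) : p v != 0 ->
    (\dim (U :&: lker p) < \dim U)%N.
  move=> pv; rewrite ltn_neqAle dimvS ?capvSl // andbT; apply: contra pv => /eqP dU.
  have /eqP e : (U :&: lker p == U)%VS by rewrite eqEdim capvSl dU leqnn.
  by move: vU; rewrite -e memv_cap memv_ker => /andP[].
have [i0|[j ij]] := vertexP i.
  have ulin : linear (phi : M -> one_mod K hn i) by move=> k x y; rewrite linearP.
  pose p := lfun_of ulin.
  have pE x : p x = phi x by exact: lfun_ofE.
  have [||s1 s2] := @subquotient_ker U _ p sU.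
  - apply: rel_homP => // k x xU; rewrite !pE.
    + rewrite phiE mE_rep /= /oE eq_sym; case: eqP => _.
        by rewrite id_lfunE.
      by rewrite zero_lfunE.
    + rewrite mA_rep zero_lfunE comp_lfunE mEA; case: eqP => [ik|_].
        by move: i0; rewrite ik.
      exact: linear0.
    + by rewrite mB_rep zero_lfunE phiB.
  - apply/eqP; rewrite eqEdim subvf dimvf /dim /= lt0n dimv_eq0.
    apply/eqP => pU; have := memv_img p vU; rewrite pU memv0 pE phiv.
    by rewrite oner_eq0.
  exists (U :&: lker p)%VS; split=> //.
  - move=> j u; rewrite memv_cap => /andP[uU _] Eu _; exists 0; first exact: mem0v.
    by rewrite linear0 -Eu Emax // i0.
  - by apply: dimlt; rewrite pE phiv oner_eq0.
  - exists (one_mod K hn i) => //; exists i; left; split=> //; exact: one_mod_L.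
pose psi := (phi \o mA M j)%VF.
have psiE x : psi x = phi (mA M j x) by rewrite comp_lfunE.
have ulin : linear ((fun x => (psi x, phi x)) : M -> nabla_mod j).
  by move=> k x y; rewrite !linearP.
pose p := lfun_of ulin.
have pE x : p x = (psi x, phi x) by exact: lfun_ofE.
have Av k : mA M k v = 0.
  have [ki|ki] := eqVneq (lower k) i; first exact: AU.
  by rewrite -Ev mAE eq_sym (negPf ki).
(* Exactness enters here: A kills [v] at the highest vertex, so [v] has a preimage [y], which maps
   onto the top of the costandard quotient. *)
have [y yU vy] : exists2 y, y \in U & v = mA M j y by apply: eU; rewrite -?ij.
have pv : p v = (0, 1) by rewrite pE psiE Av linear0 phiv.
have [||s1 s2] := @subquotient_ker U _ p sU.
- apply: rel_homP => // k x xU; rewrite !pE.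
  + rewrite two_mE /wE_fun /= phiE psiE mAE ij (eq_sym (upper j)).
    congr pair.
    by case: eqP => _; rewrite ?psiE // linear0.
  + rewrite two_mA /wN_fun /= psiE mAA linear0; congr pair.
    rewrite comp_lfunE mEA ij (inj_eq (@upper_inj _)) eq_sym.
    case: eqP => [->|_]; last exact: linear0.
    by rewrite psiE comp_lfunE mEA ij eqxx.
  + by rewrite two_mB /wN_fun /= psiE mAB linear0 phiB.
- apply/vspaceP => z; rewrite memvf; apply/memv_imgP.
  have key (a b c : K) : b = a * c + (b + a * - c) * 1.
    by rewrite mulr1 mulrN addrC subrK.
  have psiy : psi y = 1 by rewrite psiE -vy.
  (* Since [p y = (1, phi y)] and [p v = (0, 1)], the coefficient of [v] has to compensate for
     [phi y]. *)
  exists (z.1 *: y + (z.2 - z.1 * phi y) *: v); first by rewrite memvD ?memvZ.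
  rewrite linearD !linearZ /= pv pE psiy; case: z => a b; congr pair => /=.
    by rewrite scaler0 addr0 -[RHS]/(a * 1) mulr1.
  exact: key.
exists (U :&: lker p)%VS; split=> //.
- move=> l u; rewrite memv_cap memv_ker => /andP[uU /eqP pu] Eu Au.
  have [z zU uz] := eU l u uU Eu Au.
  (* The preimage [z] need not lie in the kernel of [p]. If [alpha_l] starts at [i], then [u = 0];
     otherwise the component of [z] at [lower l] works, because [phi] vanishes on it and [psi] is 0
     or [phi u], which is 0 too. *)
  have [li|li] := eqVneq (lower l) i.
    exists 0; first exact: mem0v.
    by rewrite uz linear0 AU.
  exists (mE M (lower l) z); last by rewrite mAE eqxx.
  rewrite memv_cap submodule_mE // memv_ker pE phiE (eq_sym i) (negPf li).
  suff -> : psi (mE M (lower l) z) = 0 by exact: eqxx.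
  rewrite psiE mAE; case: eqP => [lj|_]; last exact: linear0.
  have -> : mA M j z = u by rewrite uz (lower_inj lj).
  by move: pu; rewrite pE => -[_ ->].
- by apply: dimlt; rewrite pv; apply/eqP => -[/eqP]; rewrite oner_eq0.
- by exists (nabla_mod j) => //; exists (upper j); apply: nabla_modP.
Qed.

Lemma submodule0 : is_submodule (0%VS : {vspace M}).
Proof.
move=> a; apply/subvP => y /memv_imgP[x]; rewrite memv0 => /eqP-> ->.
by rewrite linear0 mem0v.
Qed.

Lemma submodule_full : is_submodule (fullv : {vspace M}).
Proof. by move=> a; apply: subvf. Qed.

Lemma Aexact_F_nabla : Aexact fullv -> F_nabla M.
Proof.
move=> eM; apply: chain_filtered.
have [d] := ubnP (\dim (fullv : {vspace M})).
move: (fullv : {vspace M}) submodule_full eM; elim: d => // d IH U sU eU le.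
have [->|U0] := eqVneq U 0%VS.
  exact/chain_refl/submodule0.
have [U' [sU' eU' lt [X XC UX]]] := nabla_step sU eU U0.
apply: chain_trans (IH U' sU' eU' _) _; first exact: leq_trans lt _.
exact: chain_step sU' XC UX (chain_refl _ sU).
Qed.

(* A standard submodule of [M / U] at the highest vertex that [M / U] meets. *)
Lemma Delta_step U : is_submodule U -> Bexact U -> U != fullv ->
  exists U', [/\ is_submodule U', Bexact U', (\dim U < \dim U')%N &
    exists2 X, exists i, is_Delta i X & subquotient_iso U U' X].
Proof.
move=> sU eU U1.
have [i [v vU] imax] : exists2 i, (exists v, mE M i v \notin U) &
    forall k : 'I_n, (i < k)%N -> ~ exists v, mE M k v \notin U.
  apply: max_vertex; apply/not_existsP => nE.
  case/negP: U1; rewrite eqEsubv subvf; apply/subvP => v _; rewrite -(mE_sum v).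
  apply: memv_suml => i _; apply/negPn/negP => Ev.
  by apply: (nE i); exists v.
have Emax (k : 'I_n) x : (i < k)%N -> mE M k x \in U.
  by move=> ik; apply/negPn/negP => Ex; apply: (imax k ik); exists x.
have Ev : mE M i (mE M i v) = mE M i v by rewrite mEE eqxx.
move: (mE M i v) vU Ev => {}v vU Ev.
have AvU k : mA M k v \in U.
  rewrite -Ev mAE; case: eqP => [ik|_]; last exact: mem0v.
  have <- : mE M (upper k) (mA M k v) = mA M k v by rewrite mEA eqxx.
  by apply: Emax; rewrite ik.
(* A B-boundary at [i] comes from the next vertex, where everything lies in [U] by the choice of
   [i]. *)
have EimB x : mE M i x \in (U + imB)%VS -> mE M i x \in U.
  case/memv_addP => u uU [_ /memv_sumP[y yB ->] xe].
  have -> : mE M i x = mE M i (mE M i x) by rewrite mEE eqxx.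
  rewrite xe linearD /= lfun_sum memvD ?submodule_mE //.
  apply: memv_suml => k _; have /memv_imgP[z _ ->] := yB k isT.
  rewrite mEB; case: eqP => [ik|_]; last exact: mem0v.
  have <- : mB M k (mE M (upper k) z) = mB M k z by rewrite mBE eqxx.
  by apply/submodule_mB => //; apply: Emax; rewrite ik.
have [phi0 phi00 phi01] := separating_functional vU.
pose phi := (phi0 \o mE M i)%VF.
have phiE k x : phi (mE M k x) = if i == k then phi x else 0.
  by rewrite !comp_lfunE mEE; case: ifP => _; rewrite ?linear0.
have phiv : phi v = 1 by rewrite comp_lfunE Ev.
have phiU x : x \in U -> phi x = 0.
  by move=> xU; rewrite comp_lfunE phi00 ?submodule_mE.
have [i0|[j ij]] := vertexP i.
  have Bv k : mB M k v = 0.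
    by rewrite -Ev mBE; case: eqP => // ik; move: i0; rewrite ik.
  have ulin : linear (phi : M -> one_mod K hn i) by move=> k x y; rewrite linearP.
  pose p := lfun_of ulin.
  have pE x : p x = phi x by exact: lfun_ofE.
  have vU' : v \in (U + <[v]>)%VS by apply: subvP (addvSr _ _) _ (memv_line v).
  have UU' := addvSl U <[v]>%VS.
  have sU' : is_submodule (U + <[v]>)%VS.
    apply: is_submoduleP => k _ /memv_addP[u uU [_ /vlineP[a ->] ->]];
      rewrite linearD linearZ /=.
    - rewrite memvD ?(subvP UU' _ (submodule_mE _ sU uU)) ?memvZ //.
      by rewrite -Ev mEE; case: eqP => [->|_]; rewrite ?mem0v // Ev.
    - by apply: (subvP UU'); rewrite memvD ?submodule_mA ?memvZ.
    - by rewrite Bv scaler0 addr0; apply/(subvP UU')/submodule_mB.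
  exists (U + <[v]>)%VS; split=> //.
  - move=> l u Eu _; apply: subvP (addvSl _ _) _ _; apply: (subvP UU').
    by rewrite -Eu; apply: Emax; rewrite i0.
  - rewrite ltn_neqAle dimvS // andbT; apply: contra vU => /eqP dU.
    have /eqP -> // : U == (U + <[v]>)%VS by rewrite eqEdim UU' dU leqnn.
  - exists (one_mod K hn i); first by exists i; left; split=> //; exact: one_mod_L.
    split=> //; exists p; split.
    + apply: rel_homP => // k _ /memv_addP[u uU [_ /vlineP[a ->] ->]].
      * rewrite !pE phiE mE_rep /= /oE eq_sym; case: eqP => _.
          by rewrite id_lfunE.
        by rewrite zero_lfunE.
      * rewrite mA_rep zero_lfunE pE phiU // linearD linearZ /=.
        by rewrite memvD ?submodule_mA ?memvZ.
      * rewrite mB_rep zero_lfunE pE linearD linearZ /= Bv scaler0 addr0 phiU //.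
        exact: submodule_mB.
    + apply/vspaceP => z; rewrite memvf; apply/memv_imgP.
      exists ((z : K) *: v); first exact: memvZ.
      by rewrite linearZ /= pE phiv -[RHS]/(z * 1) mulr1.
    + apply/vspaceP => x; rewrite memv_cap memv_ker pE.
      apply/andP/idP => [[/memv_addP[u uU [_ /vlineP[a ->] ->]]]|xU].
        rewrite linearD linearZ /= phiU // phiv add0r -[a *: 1]/(a * 1) mulr1.
        by move/eqP=> ->; rewrite scale0r addr0.
      by rewrite (subvP UU') // phiU.
pose w := mB M j v.
(* Exactness enters here: with [B_j v] in [U], the vector [v] would lie in [U + imB] and so in [U].
   As [v] and [w] sit at different vertices, they are independent modulo [U]. *)
have wU : w \notin U.
  apply: contra vU => Bv; rewrite -Ev; apply: EimB; rewrite Ev.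
  by apply: eU Bv; rewrite -ij.
have Bv k : mB M k v = if k == j then w else 0.
  rewrite -{1}Ev mBE ij (inj_eq (@upper_inj _)) eq_sym.
  by case: (eqVneq k j) => [->|].
have Ew : mE M (lower j) w = w by rewrite mEB eqxx.
have [chi0 chi00 chi01] := separating_functional wU.
pose chi := (chi0 \o mE M (lower j))%VF.
have chiE k x : chi (mE M k x) = if lower j == k then chi x else 0.
  by rewrite !comp_lfunE mEE; case: ifP => _; rewrite ?linear0.
have chiw : chi w = 1 by rewrite comp_lfunE Ew.
have chiU x : x \in U -> chi x = 0.
  by move=> xU; rewrite comp_lfunE chi00 ?submodule_mE.
have phiw : phi w = 0.
  by rewrite comp_lfunE mEB ij (negPf (upper_neq_lower j)) linear0.
have chiv : chi v = 0.
  by rewrite comp_lfunE -Ev mEE ij (negPf (lower_neq_upper j)) linear0.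
have ulin : linear ((fun x => (phi x, chi x)) : M -> Delta_mod j).
  by move=> k x y; rewrite !linearP.
pose p := lfun_of ulin.
have pE x : p x = (phi x, chi x) by exact: lfun_ofE.
(* This is a submodule because A sends [v] into [U] and both A and B kill [w], by the relations AB =
   0 and BB = 0. *)
pose U' := (U + <[v]> + <[w]>)%VS.
have UU' : (U <= U')%VS by rewrite /U' -addvA addvSl.
have vU' : v \in U' by rewrite /U' (subvP (addvSl _ _)) // (subvP (addvSr _ _)) ?memv_line.
have wU' : w \in U' by rewrite (subvP (addvSr _ _)) ?memv_line.
have U'P x : x \in U' -> exists u a b, u \in U /\ x = u + a *: v + b *: w.
  case/memv_addP => _ /memv_addP[u uU [_ /vlineP[a ->] ->]] [_ /vlineP[b ->] ->].
  by exists u, a, b.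
have Aw k : mA M k w = 0 by rewrite mAB.
have Bw k : mB M k w = 0 by rewrite mBB.
have AU' k x : x \in U' -> mA M k x \in U.
  case/U'P => u [a [b [uU ->]]]; rewrite !linearD !linearZ /= Aw scaler0 addr0.
  by rewrite memvD ?submodule_mA // memvZ.
have sU' : is_submodule U'.
  apply: is_submoduleP => k x xU'.
  - have [u [a [b [uU ->]]]] := U'P x xU'; rewrite !linearD !linearZ /=.
    rewrite !memvD ?(subvP UU' _ (submodule_mE _ sU uU)) ?memvZ //.
      by rewrite -Ev mEE; case: eqP => [->|_]; rewrite ?mem0v // Ev.
    by rewrite -Ew mEE; case: eqP => [->|_]; rewrite ?mem0v // Ew.
  - exact/(subvP UU')/AU'.
  - have [u [a [b [uU ->]]]] := U'P x xU'; rewrite !linearD !linearZ /=.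
    rewrite Bw scaler0 addr0 memvD ?(subvP UU' _ (submodule_mB _ sU uU)) ?memvZ //.
    by rewrite Bv; case: eqP => _; rewrite ?mem0v.
exists U'; split=> //.
- move=> l u Eu BuU'.
  have UimB : (U + imB <= U' + imB)%VS by apply: addvS.
  have [li|li] := ltnP i (upper l).
    by apply: (subvP UimB); apply: (subvP (addvSl _ _)); rewrite -Eu Emax.
  have [x [a [b [xU Bue]]]] := U'P _ BuU'.
  have {Bue} Bue : mB M l u = mE M (lower l) x + b *: mE M (lower l) w.
    have -> : mB M l u = mE M (lower l) (mB M l u) by rewrite mEB eqxx.
    rewrite Bue !linearD !linearZ /=; congr (_ + _).
    rewrite -Ev mEE; case: eqP => [e|_]; last by rewrite scaler0 addr0.
    by rewrite -e ltnn in li.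
  (* For [l = j] subtracting [b *: v] cancels the [w] term and leads back to exactness modulo [U].
     For other [l] the term vanishes, since [w] does not sit at [lower l]. *)
  have [lj|lj] := eqVneq l j.
    have : u - b *: v \in (U + imB)%VS.
      apply: (eU l); first by rewrite linearB linearZ /= Eu lj -ij Ev.
      by rewrite linearB linearZ /= Bue lj Ew -/w addrK submodule_mE.
    move/(subvP UimB) => ub; rewrite -(subrK (b *: v) u) memvD // memvZ //.
    exact: (subvP (addvSl _ _)).
  apply: (subvP UimB); apply: eU Eu _; rewrite Bue mEB (inj_eq (@lower_inj _)).
  by rewrite (negPf lj) scaler0 addr0 submodule_mE.
- rewrite ltn_neqAle dimvS // andbT; apply: contra vU => /eqP dU.
  have /eqP -> // : U == U' by rewrite eqEdim UU' dU leqnn.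
- exists (Delta_mod j); first by exists (upper j); apply: Delta_modP.
  split=> //; exists p; split.
  + apply: rel_homP => // k x xU'; rewrite !pE.
    * by rewrite two_mE /wE_fun /= phiE chiE ij !(eq_sym _ k).
    * by rewrite two_mA /wN_fun /= phiU ?chiU ?AU'.
    * rewrite two_mB /wN_fun /=; have [u [a [b [uU ->]]]] := U'P x xU'.
      have -> : phi (u + a *: v + b *: w) = a.
        rewrite !linearD !linearZ /= phiv phiw phiU // scaler0 addr0 add0r.
        exact: mulr1.
      have -> : mB M k (u + a *: v + b *: w) =
          mB M k u + (if k == j then a else 0) *: w.
        rewrite !linearD !linearZ /= Bw scaler0 addr0 Bv; congr (_ + _).
        by case: eqP; rewrite ?scaler0 ?scale0r.
      rewrite !linearD !linearZ /= phiw chiw phiU ?chiU ?submodule_mB //.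
      rewrite scaler0 !add0r; congr pair; exact: mulr1.
  + apply/vspaceP => z; rewrite memvf; apply/memv_imgP.
    exists (z.1 *: v + z.2 *: w); first by rewrite memvD ?memvZ.
    rewrite linearD !linearZ /= !pE phiv phiw chiv chiw.
    by case: z => a b; congr pair; rewrite /= ?scaler0 ?addr0 ?add0r
      -[RHS]/(_ * 1) mulr1.
  + apply/vspaceP => x; rewrite memv_cap memv_ker pE.
    apply/andP/idP => [[/U'P[u [a [b [uU ->]]]]]|xU].
      rewrite !linearD !linearZ /= phiU // chiU // phiv phiw chiv chiw.
      rewrite !scaler0 !addr0 !add0r -[a *: 1]/(a * 1) -[b *: 1]/(b * 1) !mulr1.
      by move=> /eqP[-> ->]; rewrite !scale0r !addr0.
    by rewrite (subvP UU') // phiU // chiU.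
Qed.

Lemma Bexact_F_Delta : Bexact 0%VS -> F_Delta M.
Proof.
move=> eM; apply: chain_filtered.
have [d] := ubnP (\dim {:M} - \dim (0%VS : {vspace M})).
move: (0%VS : {vspace M}) submodule0 eM; elim: d => // d IH U sU eU le.
have [->|U1] := eqVneq U fullv; first exact/chain_refl/submodule_full.
have [U' [sU' eU' lt [X XC UX]]] := Delta_step sU eU U1.
apply: chain_step sU XC UX (IH U' sU' eU' _).
by apply: leq_trans (ltn_sub2l _ lt) _ => //; rewrite (leq_trans lt) ?dimvS ?subvf.
Qed.

End Module.
End Filtrations.

Theorem proposition27 (K : closedFieldType) (n : nat) (hn : (2 <= n)%N)
    (M N : fdmod (Lambda K hn)) :
  F_nabla M -> F_Delta N ->
  indecomposable M -> indecomposable N ->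
  self_orthogonal M -> self_orthogonal N ->
  ~ (F_Delta M /\ F_nabla M) -> ~ (F_Delta N /\ F_nabla N) ->
  exists2 m : nat, (1 <= m)%N & ~ Ext_eq0 m M N.
Proof.
move=> FM FN _ _ _ _ nM nN.
have [j Mj] : exists j, homB (upper j) M.
  apply: contrapT => /forallNP nB; apply: nM; split; last exact: FM.
  exact/Bexact_F_Delta/Bexact0.
have [j' Nj'] : exists j, homA (upper j) N.
  apply: contrapT => /forallNP nA; apply: nN; split; first exact: FN.
  exact/Aexact_F_nabla/Aexact_full.
exact: Ext_neq0 Mj Nj'.
Qed.
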